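(* Let $q\geq 0$ and $1\leq t\leq 2^q$ be integers, and let $k\geq 2$ be an integer. (a) $\Delta(2^{q+1}-t;2/k)\leq 2^q\cdot (k+1)-t$; that is, for $d=2^q(k+1)-t$ and any $2^{q+1}-t$ masses on $\mathbb{R}^d$, there exist $k$ hyperplanes in $\mathbb{R}^d$, any two of which equipartition each of the masses. (b) $\Delta(2^{q+1}-t;3/4)\leq 7\cdot 2^q-2t$; that is, for $d=7\cdot 2^q-2t$ and any $2^{q+1}-t$ masses on $\mathbb{R}^d$, there exist $4$ hyperplanes in $\mathbb{R}^d$, any three of which equipartition each of the masses.
   Context: A mass on $\mathbb{R}^d$ is a finite (nonnegative) Borel measure on $\mathbb{R}^d$ that is absolutely continuous with respect to Lebesgue measure. A hyperplane $H=\{u\in\mathbb{R}^d:\langle u,a\rangle=b\}$ ($a\neq 0$) determines the closed half-spaces $H^+=\{\langle u,a\rangle\geq b\}$ and $H^-=\{\langle u,a\rangle\leq b\}$. Hyperplanes $H_1,\dots,H_\ell$ equipartition a mass $\mu$ if each of the $2^\ell$ regions $H_1^{\epsilon_1}\cap\cdots\cap H_\ell^{\epsilon_\ell}$, $\epsilon_i\in\{+,-\}$, has $\mu$-measure $\mu(\mathbb{R}^d)/2^\ell$. For integers $m\geq 1$ and $1\leq \ell\leq k$, $\Delta(m;\ell/k)$ denotes the minimum dimension $d$ such that for any $m$ masses on $\mathbb{R}^d$ there exist $k$ hyperplanes in $\mathbb{R}^d$, any $\ell$ of which (i.e., every $\ell$-element subcollection) equipartition each of the $m$ masses. *)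

(* Defs.v *)
From HB Require Import structures.
From mathcomp Require Import all_boot all_order all_algebra.
From mathcomp Require Import all_classical all_reals all_analysis.
Set Implicit Arguments. Unset Strict Implicit. Unset Printing Implicit Defensive.
Import Order.TTheory GRing.Theory Num.Theory.
Import numFieldNormedType.Exports.
Local Open Scope classical_set_scope.
Local Open Scope ring_scope.

Definition Rd (R : realType) (d : nat) :=
  g_sigma_algebraType (@open 'rV[R]_d).

Definition box (R : realType) (d : nat) (a b : 'rV[R]_d) : set 'rV[R]_d :=
  [set u | forall i : 'I_d, a 0 i <= u 0 i <= b 0 i].

Definition lebesgue_null (R : realType) (d : nat) (A : set 'rV[R]_d) : Prop :=
  forall eps : R, 0 < eps ->
    exists a b : nat -> 'rV[R]_d,
      (forall n (i : 'I_d), a n 0 i <= b n 0 i) /\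
      A `<=` \bigcup_n box (a n) (b n) /\
      (\sum_(n <oo) ((\prod_(i < d) (b n 0 i - a n 0 i))%:E) < eps%:E)%E.

(* A mass on R^d: a finite Borel measure, absolutely continuous w.r.t.
   Lebesgue measure (this is the extra predicate). *)
Definition abs_continuous (R : realType) (d : nat)
  (mu : {finite_measure set (Rd R d) -> \bar R}) : Prop :=
  forall A : set (Rd R d), measurable A -> lebesgue_null A -> mu A = 0%E.

Definition dotv (R : realType) (d : nat) (u a : 'rV[R]_d) : R :=
  \sum_(i < d) u 0 i * a 0 i.

(* A hyperplane is a pair (a, b) with a <> 0: H = {u | <u,a> = b}.
   Closed half-spaces: H^+ (sign true) and H^- (sign false). *)
Definition halfspace (R : realType) (d : nat) (H : 'rV[R]_d * R) (s : bool)
  : set 'rV[R]_d :=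
  [set u | if s then H.2 <= dotv u H.1 else dotv u H.1 <= H.2].

Definition equipartitions (R : realType) (d k : nat)
  (H : 'I_k -> 'rV[R]_d * R) (S : {set 'I_k})
  (mu : {finite_measure set (Rd R d) -> \bar R}) : Prop :=
  forall eps : 'I_k -> bool,
    mu [set u | forall i, i \in S -> halfspace (H i) (eps i) u] =
    (mu setT * ((2%:R ^- #|S|)%:E))%E.

(* "For any m masses on R^d there exist k hyperplanes in R^d any l of which
   equipartition each of the m masses."  Delta(m; l/k) <= d is this
   property in dimension d. *)
Definition equipart_property (R : realType) (m l k d : nat) : Prop :=
  forall mu : 'I_m -> {finite_measure set (Rd R d) -> \bar R},
    (forall j, abs_continuous (mu j)) ->
    exists H : 'I_k -> 'rV[R]_d * R,
      (forall i, (H i).1 != 0) /\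
      (forall S : {set 'I_k}, #|S| = l -> forall j, equipartitions H S (mu j)).

(* Main.v *)
Require Import Defs.
From HB Require Import structures.
From mathcomp Require Import all_boot all_order all_algebra all_fingroup.
Set Implicit Arguments. Unset Strict Implicit. Unset Printing Implicit Defensive.
From mathcomp Require Import ring lra zify.
Import Order.TTheory GRing.Theory Num.Theory.
Local Open Scope ring_scope.
From mathcomp Require mpoly.

(** A point of the product of [k] cubes of dimension [d] gives [k] hyperplanes:
    a row [x] is the normal vector, and the offset is [prod_j (1 - x_j ^ 2)].
    Antipodal boundary points of a cube give opposite orientations of the same
    hyperplane, so the cubes modulo these identifications are projective spaces.
    For a mass and a set [A] of hyperplanes, the integral of the product of the
    sides of the hyperplanes in [A] changes sign exactly when a hyperplane of
    [A] is reversed.  If these integrals vanish for all nonempty subsets of [S],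
    then Fourier inversion shows that [S] equipartitions the mass.

    Functions with such symmetries, indexed by sets [A_c], have a common zero as
    soon as [prod_i x_i ^ d] has an odd coefficient in
    [prod_c sum_(i in A_c) x_i].  On a fine grid of the parameter space, consider
    the sum over all maximal flags of cells of the cup product of the
    coboundaries of the signs of the functions.  Modulo 2 it depends only on the
    symmetries, because the facets of flags cancel in pairs, and for
    lexicographic signs exactly one flag contributes for each term of the
    coefficient.  So there is a flag along which every function changes sign, and
    a limit of such flags is a common zero.

    For pairs, the exponent [2 ^ (q + 1) - 1] is a sum of powers of 2 and the
    Vandermonde determinant makes a suitable coefficient a count of tuples of
    permutations, which turns out to be 1.  For triples, a descent with the
    Cartier operator halves [t]. *)

(** * Cup products of sign functions over flags of cells *)

Lemma F2_addxx (x : 'F_2) : x + x = 0.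
Proof. by case: x => [[|[|x]] Hx] //; apply/val_inj. Qed.

Lemma F2_oppr (x : 'F_2) : - x = x.
Proof. by apply: (addrI x); rewrite subrr F2_addxx. Qed.

Lemma F2_neq0 (x : 'F_2) : x != 0 -> x = 1.
Proof. by case: x => [[|[|x]] Hx] // _; apply/val_inj. Qed.

(** Comparing the ranks of [x] and [f x] picks one point of each orbit; the two halves have equal
    sums, which cancel modulo 2. *)
Lemma sum_involution_F2 (T : finType) (f : T -> T) (F : T -> 'F_2) :
  involutive f -> (forall x, f x != x) -> (forall x, F (f x) = F x) ->
  \sum_x F x = 0.
Proof.
move=> fK fN Ff.
pose P x := (enum_rank x < enum_rank (f x))%N.
have PN x : ~~ P x = P (f x).
  rewrite /P fK -leqNgt leq_eqVlt; case: eqP => //= /val_inj /enum_rank_inj E.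
  by move: (fN x); rewrite E eqxx.
rewrite (bigID P) /= [X in _ + X](reindex_inj (can_inj fK)) /=.
rewrite [X in _ + X](eq_big P F) ?F2_addxx // => x.
by rewrite PN fK.
Qed.

Lemma bumpS0 h a : bump (bump 0 h) a.+1 = (bump h a).+1.
Proof. by rewrite /bump add1n ltnS addnS. Qed.

Section Cup.
Variable V : Type.
Implicit Types (ss : seq (V -> 'F_2)) (z : nat -> V).

(** The cup product of the coboundaries of the 0-cochains [ss] on the simplex with vertices [z 0],
    [z 1], ...; modulo 2 the coboundary on an edge is the sum of its two end values. *)
Fixpoint cup ss z : 'F_2 :=
  if ss is s :: ss' then (s (z 0) + s (z 1)) * cup ss' (fun a => z a.+1) else 1.

(* The cup product of the coboundaries of [ss1], the 0-cochain [g] and the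
   coboundaries of [ss2]. *)
Fixpoint cup0 ss1 (g : V -> 'F_2) ss2 z : 'F_2 :=
  if ss1 is s :: ss1' then
    (s (z 0) + s (z 1)) * cup0 ss1' g ss2 (fun a => z a.+1)
  else g (z 0) * cup ss2 z.

Lemma eq_cup ss z z' :
  (forall a, (a <= size ss)%N -> z a = z' a) -> cup ss z = cup ss z'.
Proof.
elim: ss z z' => //= s ss IH z z' E.
by rewrite (E 0) // (E 1) // (IH _ (fun a => z' a.+1)) // => a Ha; apply: E.
Qed.

Lemma eq_cup0 ss1 g ss2 z z' :
  (forall a, (a <= size ss1 + size ss2)%N -> z a = z' a) ->
  cup0 ss1 g ss2 z = cup0 ss1 g ss2 z'.
Proof.
elim: ss1 z z' => /= [|s ss IH] z z' E.
  by rewrite (E 0) // (eq_cup E).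
by rewrite (E 0) // (E 1) // (IH _ (fun a => z' a.+1)) // => a Ha; apply: E.
Qed.

(** Cocycle property of a product of coboundaries; [bump j] omits the vertex [j]. Only the facets
    omitting vertex 0 or 1 alter the first factor, and the induction hypothesis collapses the others
    to one term. *)
Lemma cup_face ss z :
  \sum_(j < (size ss).+2) cup ss (fun a => z (bump j a)) = 0.
Proof.
elim: ss z => [|s ss IH] z /=.
  by rewrite big_ord_recl big_ord1 /= F2_addxx.
have := IH (fun a => z a.+1).
rewrite big_ord_recl /= => /(canRL (addKr _)); rewrite addr0 => IH1.
rewrite 2!big_ord_recl /= (eq_bigr (fun j : 'I_(size ss).+1 =>
  (s (z 0) + s (z 1)) * cup ss (fun a => z (bump (bump 0 j) a).+1))); last first.
  by move=> j _; congr (_ * _); apply: eq_cup => a _; rewrite bumpS0.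
rewrite -big_distrr /= IH1.
set c := cup ss (fun a => z (bump 0 a).+1); move: c => c.
rewrite F2_oppr -!mulrDl.
(* The coboundary of [s] sums to zero around the triangle [z 0], [z 1], [z 2]. *)
have E (x y t : 'F_2) : y + t + (x + t + (x + y)) = 0.
  by rewrite -[RHS](F2_addxx (x + y + t)); ring.
by rewrite E mul0r.
Qed.

(** Leibniz rule: all factors but [g] are closed, so the coboundary of the product only replaces [g]
    by its coboundary. *)
Lemma cup0_face ss1 g ss2 z :
  \sum_(j < (size ss1 + size ss2).+2) cup0 ss1 g ss2 (fun a => z (bump j a)) =
  cup (ss1 ++ g :: ss2) z.
Proof.
elim: ss1 z => [|s ss IH] z /=.
  have := cup_face ss2 z.
  rewrite big_ord_recl /= => /(canRL (addKr _)); rewrite addr0 => IH1.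
  rewrite big_ord_recl (eq_bigr (fun j : 'I_(size ss2).+1 =>
    g (z 0) * cup ss2 (fun a => z (bump (lift ord0 j) a)))) //.
  rewrite -big_distrr IH1 /=; set c := cup ss2 _.
  by rewrite F2_oppr -mulrDl addrC.
rewrite -IH 2!big_ord_recl (eq_bigr (fun j : 'I_(size ss + size ss2).+1 =>
  (s (z 0) + s (z 1)) * cup0 ss g ss2 (fun a => z (bump (bump 0 j) a).+1)));
  last first.
  by move=> j _; congr (_ * _); apply: eq_cup0 => a _; rewrite bumpS0.
rewrite -big_distrr [in RHS]big_ord_recl.
rewrite /=; set c := cup0 ss g ss2 (fun a => z (bump 0 a).+1); move: c => c.
rewrite addrA -mulrDl mulrDr; congr (_ * _ + _).
have E (x y t : 'F_2) : y + t + (x + t) = x + y.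
  by rewrite -[RHS]addr0 -(F2_addxx t); ring.
exact: E.
Qed.

Lemma cup_prod (s : nat -> V -> 'F_2) n z :
  cup (mkseq s n) z = \prod_(a < n) (s a (z a) + s a (z a.+1)).
Proof.
rewrite /mkseq; elim: n s z => [|n IH] s z; first by rewrite big_ord0.
rewrite big_ord_recl /= (iotaDl 1 0) -map_comp.
by rewrite (IH (fun a => s a.+1)).
Qed.

Lemma cup_linear ss1 ss2 (g g' : V -> 'F_2) z :
  cup (ss1 ++ (fun v => g v + g' v) :: ss2) z =
  cup (ss1 ++ g :: ss2) z + cup (ss1 ++ g' :: ss2) z.
Proof.
elim: ss1 z => [|s ss1 IH] z /=; last by rewrite IH mulrDr.
by rewrite -mulrDl addrACA.
Qed.
End Cup.

(** * Flags of cubical cells and the pairing of their facets *)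

Section Grid.
Variables (n k M : nat) (blk : 'I_n -> 'I_k).
Hypothesis (n_gt0 : (0 < n)%N) (M_gt0 : (0 < M)%N).

(* Vertices are the cells of the cubical grid on [[0, M]^n], in doubled
   coordinates: an even coordinate is a grid value, an odd one an interval. *)
Local Notation vertex := {ffun 'I_n -> nat}.

(* A maximal flag of cells inside the top cell [y]: it starts at the corner
   [y + e], and the coordinate [r] becomes an interval at step [p r]. *)
Definition flag := ({ffun 'I_n -> 'I_M} * {ffun 'I_n -> bool} * 'S_n)%type.

Definition vert (F : flag) (j : nat) : vertex :=
  let: (y, e, p) := F in
  [ffun r => if (p r < j)%N then (y r).*2.+1 else (y r + e r).*2].

Definition antipode (i : 'I_k) (v : vertex) : vertex :=
  [ffun r => if blk r == i then (M.*2 - v r)%N else v r].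

Definition on_boundary (i : 'I_k) (v : vertex) : Prop :=
  (forall r, v r <= M.*2)%N /\
  exists r, blk r = i /\ (v r = 0%N \/ v r = M.*2).

Definition equivariant (A : {set 'I_k}) (s : vertex -> 'F_2) : Prop :=
  forall i v, on_boundary i v -> s (antipode i v) = s v + (i \in A)%:R.

Lemma vert_le F j r : (vert F j r <= M.*2)%N.
Proof.
case: F => [[y e] p]; rewrite ffunE; have := ltn_ord (y r).
by case: (e r); case: ifP => _; lia.
Qed.

(** The involutions [flip_first], [swap_at] at consecutive steps, and [exit_last] pair off flags
    with a common facet: they change only the first, an inner, or the last vertex, up to an antipode
    in the last case. *)
Definition flip_at (r : 'I_n) (F : flag) : flag :=
  let: (y, e, p) := F in (y, [ffun x => e x (+) (x == r)], p).

Definition swap_at (a b : 'I_n) (F : flag) : flag :=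
  let: (y, e, p) := F in (y, e, (p * tperm a b)%g).

Definition step_coord (F : flag) (a : 'I_n) : 'I_n := (F.2^-1)%g a.

Definition flip_first (F : flag) : flag :=
  flip_at (step_coord F (Ordinal n_gt0)) F.

Lemma flip_firstK : involutive flip_first.
Proof.
case=> [[y e] p]; rewrite /flip_first /=; congr (_, _, _).
by apply/ffunP => r; rewrite !ffunE -addbA addbb addbF.
Qed.

Lemma flip_first_neq F : flip_first F != F.
Proof.
case: F => [[y e] p]; apply/eqP => -[] /ffunP /(_ ((p^-1)%g (Ordinal n_gt0))).
by rewrite ffunE eqxx; case: (e _).
Qed.

Lemma vert_flip_first F j : (0 < j)%N -> vert (flip_first F) j = vert F j.
Proof.
case: F => [[y e] p] j0; apply/ffunP => r; rewrite !ffunE.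
case: ifP => // pj; case: eqP => [rE|_]; last by rewrite addbF.
by move: pj; rewrite rE permKV j0.
Qed.

Lemma swap_atK a b : involutive (swap_at a b).
Proof. by case=> [[y e] p] /=; rewrite -mulgA tperm2 mulg1. Qed.

Lemma swap_at_neq a b F : a != b -> swap_at a b F != F.
Proof.
case: F => [[y e] p] ab; apply/eqP => -[] /permP /(_ ((p^-1)%g a)).
by rewrite permM permKV tpermL => /eqP; rewrite eq_sym (negbTE ab).
Qed.

Lemma vert_swap_at (a b : 'I_n) F (j : nat) :
  b = a.+1 :> nat -> j != b -> vert (swap_at a b F) j = vert F j.
Proof.
case: F => [[y e] p] ba jb; apply/ffunP => r; rewrite !ffunE permM.
suff -> : (tperm a b (p r) < j)%N = (p r < j)%N by [].
by case: tpermP => [->|->|//]; apply/idP/idP; lia.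
Qed.

Lemma rev_ltn (y : 'I_M) : (M.-1 - y < M)%N. Proof. by have := ltn_ord y; lia. Qed.

Definition block_flip (i : 'I_k) (F : flag) : flag :=
  let: (y, e, p) := F in
  ([ffun x => if blk x == i then Ordinal (rev_ltn (y x)) else y x],
   [ffun x => e x (+) (blk x == i)], p).

(** Clamped at the end of the range; [exit_last] crosses a facet only at an interior corner value,
    where no clamping occurs. *)
Definition ord_add1 (y : 'I_M) : 'I_M := insubd y y.+1.
Definition ord_sub1 (y : 'I_M) : 'I_M := insubd y y.-1.

Definition cross_at (r : 'I_n) (F : flag) : flag :=
  let: (y, e, p) := F in
  ([ffun x => if x == r then if e r then ord_add1 (y r) else ord_sub1 (y r) else y x],
   [ffun x => e x (+) (x == r)], p).

Lemma pred_n_ltn : (n.-1 < n)%N. Proof. by rewrite ltn_predL. Qed.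

Definition last_ord : 'I_n := Ordinal pred_n_ltn.

Definition corner (F : flag) (r : 'I_n) : nat := F.1.1 r + F.1.2 r.

(* Leaves the last cell of the flag through the facet that the flag meets: to
   the neighbouring cell, or to the antipode when the facet is on the boundary. *)
Definition exit_last (F : flag) : flag :=
  let r := step_coord F last_ord in
  if (0 < corner F r < M)%N then cross_at r F else block_flip (blk r) F.

Lemma ord_add1E (y : 'I_M) : (y.+1 < M)%N -> ord_add1 y = y.+1 :> nat.
Proof. by move=> h; rewrite /ord_add1 val_insubd h. Qed.

Lemma ord_sub1E (y : 'I_M) : ord_sub1 y = y.-1 :> nat.
Proof. by rewrite /ord_sub1 val_insubd; have := ltn_ord y; case: ifP => //; lia. Qed.

Lemma cross_atK r F : (0 < corner F r < M)%N -> cross_at r (cross_at r F) = F.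
Proof.
case: F => [[y e] p]; rewrite /corner /= => h; congr (_, _, _); last first.
  by apply/ffunP => x; rewrite !ffunE -addbA addbb addbF.
apply/ffunP => x; rewrite !ffunE eqxx addbT; case: eqP => // ->.
apply/val_inj; move: h; case: (e r) => /= /andP[h1 h2].
  by rewrite ord_sub1E ord_add1E; lia.
by rewrite ord_add1E ord_sub1E; lia.
Qed.

Lemma block_flipK i : involutive (block_flip i).
Proof.
case=> [[y e] p] /=; congr (_, _, _); apply/ffunP => x; last first.
  by rewrite !ffunE -addbA addbb addbF.
apply/val_inj; rewrite ffunE; case E: (blk x == i) => /=; rewrite ffunE E //=.
by have := ltn_ord (y x); lia.
Qed.

Lemma corner_cross_at r F : (0 < corner F r < M)%N ->
  corner (cross_at r F) r = corner F r.
Proof.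
case: F => [[y e] p]; rewrite /corner /= !ffunE eqxx addbT.
by case: (e r) => /= /andP[h1 h2]; rewrite ?ord_sub1E ?ord_add1E; lia.
Qed.

Lemma corner_block_flip r F : 
  corner (block_flip (blk r) F) r = (M - corner F r)%N.
Proof.
case: F => [[y e] p]; rewrite /corner /= !ffunE eqxx addbT /=.
by have := ltn_ord (y r); case: (e r) => /=; lia.
Qed.

Lemma exit_lastK : involutive exit_last.
Proof.
move=> F; rewrite {2}/exit_last; case: ifP => h.
  have E : step_coord (cross_at (step_coord F last_ord) F) last_ord =
      step_coord F last_ord by case: F {h} => [[]].
  by rewrite /exit_last E corner_cross_at // h cross_atK.
have E : step_coord (block_flip (blk (step_coord F last_ord)) F) last_ord =
    step_coord F last_ord by case: F {h} => [[]].
rewrite /exit_last E corner_block_flip; case: ifP => h'; last exact: block_flipK.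
have : (corner F (step_coord F last_ord) <= M)%N.
  case: F {h h' E} => [[y e] p]; rewrite /corner /=; move: (step_coord _ _) => r.
  by have := ltn_ord (y r); case: (e r); lia.
by move: h h'; lia.
Qed.

Lemma exit_last_neq F : exit_last F != F.
Proof.
rewrite /exit_last; case: F => [[y e] p]; set r := step_coord _ _.
by case: ifP => _; apply/eqP => -[] _ /ffunP /(_ r); rewrite ffunE eqxx;
  case: (e r).
Qed.

Definition fixes_bdry (g : vertex -> 'F_2) :=
  forall i v, on_boundary i v -> g (antipode i v) = g v.

Lemma step_coordK (F : flag) (a : 'I_n) : F.2 (step_coord F a) = a.
Proof. by rewrite /step_coord permKV. Qed.

(** The last coordinate to open has its corner value in all vertices but the last. An interior
    corner value is shared by two adjacent cells; an extreme one puts these vertices on the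
    boundary, where reflecting the block gives their antipodes. *)
Lemma vert_exit_last F : 
  (forall j, (j < n)%N -> vert (exit_last F) j = vert F j) \/
  (exists i, forall j, (j < n)%N -> on_boundary i (vert F j) /\
     vert (exit_last F) j = antipode i (vert F j)).
Proof.
rewrite /exit_last; set r := step_coord F last_ord.
have pr : F.2 r = last_ord by rewrite step_coordK.
case: ifP => h; [left => j jn|right; exists (blk r) => j jn].
  case: F r pr h => [[y e] p] r /= pr; rewrite /corner /= => h.
  apply/ffunP => x; rewrite !ffunE; case: (x =P r) => [->|_]; last first.
    by rewrite addbF.
  rewrite pr /= ltnNge -ltnS prednK // jn /= addbT.
  by move: h; case: (e r) => /= /andP[h1 h2]; rewrite ?ord_sub1E ?ord_add1E; lia.
split.
  split; first exact: vert_le.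
  exists r; split=> //.
  case: F r pr h => [[y e] p] r /= pr; rewrite /corner /= => h.
  rewrite ffunE pr /= ltnNge -ltnS prednK // jn /=.
  by have := ltn_ord (y r); move: h; case: (e r) => /=; lia.
case: F r {pr h} => [[y e] p] r /=.
apply/ffunP => x; rewrite !ffunE; case: (blk x =P blk r) => _; last first.
  by rewrite addbF.
by have := ltn_ord (y x); rewrite addbT /=; case: ifP => _; case: (e x) => /=; lia.
Qed.

Fixpoint equivariants (ss : seq (vertex -> 'F_2)) : Prop :=
  if ss is s :: ss' then (exists A, equivariant A s) /\ equivariants ss' else True.

Lemma cup_antipode ss i z : equivariants ss ->
  (forall a, (a <= size ss)%N -> on_boundary i (z a)) ->
  cup ss (fun a => antipode i (z a)) = cup ss z.
Proof.
elim: ss z => //= s ss IH z [[A sA] eqs] zb.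
rewrite (IH (fun a => z a.+1)) ?(sA _ _ (zb 0%N isT)) ?(sA _ _ (zb 1%N isT)) //;
  last by move=> a; apply: (zb a.+1).
by rewrite addrACA F2_addxx addr0.
Qed.

Lemma cup0_antipode ss1 g ss2 i z : equivariants ss1 -> fixes_bdry g ->
  equivariants ss2 ->
  (forall a, (a <= size ss1 + size ss2)%N -> on_boundary i (z a)) ->
  cup0 ss1 g ss2 (fun a => antipode i (z a)) = cup0 ss1 g ss2 z.
Proof.
elim: ss1 z => [|s ss IH] z /=.
  by move=> _ gb eqs zb; rewrite cup_antipode // gb //; apply: zb.
move=> [[A sA] eqs1] gb eqs2 zb.
rewrite (IH (fun a => z a.+1)) ?(sA _ _ (zb 0%N isT)) ?(sA _ _ (zb 1%N isT)) //;
  last by move=> a; apply: (zb a.+1).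
by rewrite addrACA F2_addxx addr0.
Qed.

Definition flag_sum (ss : seq (vertex -> 'F_2)) : 'F_2 := \sum_F cup ss (vert F).

(** By [cup0_face] this is a sum over flags and omitted vertices [j]. For each [j] an involution
    pairs flags whose facets are equal or antipodal, and antipodal facets have equal values. *)
Lemma flag_sum_coboundary ss1 g ss2 : equivariants ss1 -> fixes_bdry g ->
  equivariants ss2 -> (size ss1 + size ss2).+1 = n ->
  flag_sum (ss1 ++ g :: ss2) = 0.
Proof.
move=> eqs1 gb eqs2 sz; rewrite /flag_sum.
under eq_bigr => F _ do rewrite -cup0_face.
rewrite exchange_big big1 //= => -[j /= jn] _.
have [->|j0] := posnP j.
  apply: (sum_involution_F2 flip_firstK flip_first_neq) => F.
  by apply: eq_cup0 => a _; rewrite vert_flip_first.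
have [jn'|nj] := ltnP j n; last first.
  have {nj jn}-> : j = n by rewrite sz in jn; lia.
  apply: (sum_involution_F2 exit_lastK exit_last_neq) => F.
  have E a : (a <= size ss1 + size ss2)%N -> (bump n a < n)%N /\ bump n a = a.
    by rewrite /bump; lia.
  have [H|[i H]] := vert_exit_last F.
    by apply: eq_cup0 => a /E[h1 h2]; apply: H.
  rewrite -(@cup0_antipode ss1 g ss2 i (fun a => vert F (bump n a))) //.
    by apply: eq_cup0 => a /E[h1 h2]; apply: (H _ h1).2.
  by move=> a /E[h1 h2]; apply: (H _ h1).1.
have jp : (j.-1 < n)%N by lia.
pose a := Ordinal jp; pose b := Ordinal jn'.
have ab : b = a.+1 :> nat by rewrite /= prednK.
apply: (sum_involution_F2 (swap_atK a b)) => F.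
  by apply: swap_at_neq; apply/eqP => /(congr1 val) /=; lia.
apply: eq_cup0 => c _; apply: vert_swap_at => //.
by rewrite eq_sym; apply: neq_bump.
Qed.

Lemma flag_sum_linear ss1 g g' ss2 :
  flag_sum (ss1 ++ (fun v => g v + g' v) :: ss2) =
  flag_sum (ss1 ++ g :: ss2) + flag_sum (ss1 ++ g' :: ss2).
Proof. by rewrite /flag_sum -big_split; apply: eq_bigr => F _; rewrite cup_linear. Qed.

(** Two functions with the same symmetry differ by one that is invariant under antipodes, whose
    coboundary contributes zero. *)
Lemma flag_sum_replace ss1 A g g' ss2 : equivariants ss1 -> equivariants ss2 ->
  equivariant A g -> equivariant A g' -> (size ss1 + size ss2).+1 = n ->
  flag_sum (ss1 ++ g :: ss2) = flag_sum (ss1 ++ g' :: ss2).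
Proof.
move=> eqs1 eqs2 gA gA' sz.
apply/eqP; rewrite -subr_eq0 F2_oppr -flag_sum_linear flag_sum_coboundary //.
move=> i v vb; rewrite gA // gA' // addrACA F2_addxx addr0 //.
Qed.

Lemma flag_sum_indep (A : nat -> {set 'I_k}) (s s' : nat -> vertex -> 'F_2) :
  (forall a, (a < n)%N -> equivariant (A a) (s a)) ->
  (forall a, (a < n)%N -> equivariant (A a) (s' a)) ->
  flag_sum (mkseq s n) = flag_sum (mkseq s' n).
Proof.
move=> sA sA'.
(* Hybrid family: the first [c] functions are already those of [s']. *)
pose h c a := if (a < c)%N then s' a else s a.
have hA c a : (a < n)%N -> equivariant (A a) (h c a).
  by move=> an; rewrite /h; case: ifP => _; [exact: sA'|exact: sA].
have eqh c m l : (m + l <= n)%N -> equivariants (map (h c) (iota m l)).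
  elim: l m => //= l IH m ml; split; last by apply: IH; rewrite addSnnS.
  by exists (A m); apply: hA; lia.
have split_h c d : (d < n)%N -> mkseq (h c) n =
    map (h c) (iota 0 d) ++ h c d :: map (h c) (iota d.+1 (n - d.+1)).
  move=> dn; rewrite /mkseq -[d.+1]/(0 + d).+1 -[h c d :: _]/(map _ (iota (0 + d) _.+1)).
  by rewrite -map_cat -iotaD; congr (map _ (iota _ _)); lia.
have E0 : mkseq s n = mkseq (h 0) n by apply: eq_mkseq => a.
have En : mkseq s' n = mkseq (h n) n.
  by apply/eq_in_map => a; rewrite mem_iota /h /= => ->.
rewrite E0 En.
suff H c : (c <= n)%N -> flag_sum (mkseq (h 0) n) = flag_sum (mkseq (h c) n).
  exact: H.
elim: c => // c IH cn; rewrite IH ?(ltnW cn) // (split_h c c) // (split_h c.+1 c) //.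
have -> : [seq h c.+1 i | i <- iota 0 c] = [seq h c i | i <- iota 0 c].
  by apply/eq_in_map => a; rewrite mem_iota /h => /andP[_ h2]; rewrite !ifT //; lia.
have -> : [seq h c.+1 i | i <- iota c.+1 (n - c.+1)] =
    [seq h c i | i <- iota c.+1 (n - c.+1)].
  apply/eq_in_map => a; rewrite mem_iota /h /=.
  by move=> /andP[h1 _]; rewrite !ifF //; lia.
apply: (@flag_sum_replace _ (A c)); rewrite ?size_map ?size_iota.
- by apply: eqh; lia.
- by apply: eqh; lia.
- exact: hA.
- exact: hA.
- lia.
Qed.
End Grid.

(** The least moved point [a] would have its preimage after it in the same fibre, so [p a < a]; then
    [p a] is fixed by minimality, against injectivity. *)
Lemma perm_monotone_fibers (n : nat) (T : eqType) (f : 'I_n -> T) (p : 'S_n) :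
  (forall a, f (p a) = f a) ->
  (forall a b : 'I_n, f a = f b -> (a < b)%N -> (p a < p b)%N) -> p = 1%g.
Proof.
move=> fp pm; apply/permP => a; rewrite perm1.
have [l] := ubnP a; elim: l a => // l IH a; rewrite ltnS => al.
pose b := (p^-1)%g a.
have pb : p b = a by rewrite permKV.
have fb : f b = f a by rewrite -pb fp.
have [ba|ab|/val_inj E] := ltngtP b a; last by rewrite -{1}E.
  have Eb : p b = b by apply: IH; exact: leq_trans ba al.
  by move: ba; rewrite -Eb pb ltnn.
have pab : (p a < a)%N by rewrite -{2}pb; apply: pm.
have : p (p a) = p a by apply: IH; exact: leq_trans pab al.
by move=> /perm_inj E; move: pab; rewrite E ltnn.
Qed.

(** * Lexicographic signs and the flags that contribute *)

Section FlagCount.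
Variables (n k m : nat) (blk : 'I_n -> 'I_k).
Hypothesis (n_gt0 : (0 < n)%N) (m_gt0 : (0 < m)%N).
Local Notation M := m.*2.
Local Notation vertex := {ffun 'I_n -> nat}.
Local Notation flag := (flag n M).
Implicit Types (v w : vertex) (p : 'S_n) (x r : 'I_n) (b : 'I_k).

(* The coordinate of the block [b] of highest priority off the centre [M]. *)
Definition leading p b v r :=
  [&& blk r == b, v r != M &
   [forall r', (blk r' == b) ==> (p r < p r')%N ==> (v r' == M)]].

(* Lexicographic positivity of the block [b], where the coordinates are compared
   by the priority [p] and all of them but [x] are read with reversed sign. *)
Definition lex_sign p x b v : bool :=
  [exists r, leading p b v r && (if r == x then M < v r else v r < M)%N].

Lemma leading_uniq p b v r r' : leading p b v r -> leading p b v r' -> r = r'.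
Proof.
case/and3P => /eqP rb rM /forallP rp /and3P[/eqP r'b r'M /forallP r'p].
have [h|h|/val_inj/perm_inj//] := ltngtP (p r) (p r').
  by move: (rp r'); rewrite r'b eqxx h (negbTE r'M).
by move: (r'p r); rewrite rb eqxx h (negbTE rM).
Qed.

Lemma leading_exists p b v r : blk r = b -> v r != M ->
  exists r', leading p b v r' /\ (p r <= p r')%N.
Proof.
move=> rb rM; pose P r := (blk r == b) && (v r != M).
have Pr : P r by rewrite /P rb eqxx rM.
case: (arg_maxnP (fun r => val (p r)) Pr) => r' /andP[r'b r'M] r'max.
exists r'; split; last exact: r'max.
rewrite /leading r'b r'M; apply/forallP => r2; apply/implyP => r2b.
apply/implyP => h; apply/negPn/negP => r2M.
by move: (r'max r2); rewrite /P r2b r2M => /(_ isT) /=; rewrite leqNgt h.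
Qed.

Lemma lex_signP p x b v : reflect
  (exists r, leading p b v r /\ (if r == x then M < v r else v r < M)%N)
  (lex_sign p x b v).
Proof.
by apply: (iffP existsP) => -[r]; [move=> /andP[]|move=> [h1 h2]]; exists r;
  rewrite ?h1.
Qed.

Lemma leading_sign p x b v r : leading p b v r ->
  lex_sign p x b v = (if r == x then M < v r else v r < M)%N.
Proof.
move=> lr; apply/lex_signP/idP => [[r' [lr']]|h]; last by exists r.
by rewrite (leading_uniq lr lr').
Qed.

Lemma eq_lex_sign p x b v w :
  (forall r, blk r = b -> ((v r < M) = (w r < M)) /\ ((M < v r) = (M < w r)))%N ->
  lex_sign p x b v = lex_sign p x b w.
Proof.
move=> E.
have E' r : blk r = b -> (v r == M) = (w r == M).
  by move=> /E[]; lia.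
apply: eq_existsb => r; rewrite /leading.
case: (blk r =P b) => //= rb; rewrite (E r rb).1 (E r rb).2 (E' r rb).
congr (_ && _ && _); apply: eq_forallb => r'.
by case: (blk r' =P b) => //= r'b; rewrite (E' r').
Qed.

(** A boundary vertex for the block [i] has a coordinate of that block off the centre, hence a
    leading one; the antipode keeps it leading and reflects it in the centre. *)
Lemma lex_sign_equivariant p x b :
  equivariant M blk [set b] (fun v => (lex_sign p x b v)%:R).
Proof.
move=> i v [vM [r [ri rM]]]; rewrite inE.
case: (i =P b) => [ib|ib]; last first.
  rewrite addr0; congr (_%:R); congr nat_of_bool; apply: eq_lex_sign => r' r'b.
  by rewrite ffunE r'b; case: (b =P i) => // bi; case: ib.
have rb : blk r = b by rewrite ri.
have rN : v r != M by apply/eqP; move: rM m_gt0; lia.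
have [r' [lr' _]] := leading_exists p rb rN.
have lr2 : leading p b (antipode M blk i v) r'.
  move: lr'; rewrite /leading => /and3P[r'b r'M /forallP r'p].
  rewrite r'b !ffunE ib r'b; apply/and3P; split=> //.
    by apply/eqP; move: r'M (vM r'); lia.
  apply/forallP => r2; apply/implyP => r2b; apply/implyP => h.
  rewrite ffunE r2b; move: (r'p r2); rewrite r2b h /= => /eqP ->.
  by apply/eqP; lia.
rewrite (leading_sign x lr') (leading_sign x lr2) ffunE ib.
move: lr' => /and3P[-> r'M _]; move: (vM r') => h.
have negb_F2 (c : bool) : (~~ c)%:R = c%:R + 1 :> 'F_2 by case: c; apply/val_inj.
rewrite -negb_F2; congr (_%:R); congr nat_of_bool.
by case: ifP => _; move: r'M h; lia.
Qed.

Lemma vert_step (F : flag) (a : 'I_n) r : r != step_coord F a ->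
  vert F a.+1 r = vert F a r.
Proof.
case: F => [[y e] p] /= ra; rewrite !ffunE.
suff -> : (p r < a.+1)%N = (p r < a)%N by [].
have : p r != a by apply: contra ra => /eqP <-; rewrite /step_coord permK.
by rewrite -val_eqE /=; lia.
Qed.

Lemma vert_at_step (F : flag) (a : 'I_n) :
  vert F a (step_coord F a) = (corner F (step_coord F a)).*2 /\
  vert F a.+1 (step_coord F a) = (F.1.1 (step_coord F a)).*2.+1.
Proof.
have := step_coordK F a; move: (step_coord F a) => r.
by case: F => [[y e] p] /= pr; rewrite !ffunE pr ltnn ltnSn.
Qed.

(** The moved coordinate must start at the centre, else no comparison with [M] changes. A coordinate
    of the block that is already an interval is off the centre, and at higher priority it would keep
    [r] from leading. *)
Lemma lex_sign_step p x b (F : flag) (a : 'I_n) (r := step_coord F a) :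
  lex_sign p x b (vert F a) != lex_sign p x b (vert F a.+1) ->
  [/\ blk r = b, corner F r = m &
      forall r', blk r' = b -> (F.2 r' < a)%N -> (p r' < p r)%N].
Proof.
move=> fl; have [Ev Ew] := vert_at_step F a; rewrite -/r in Ev Ew.
have Eo r' : r' != r -> vert F a.+1 r' = vert F a r' by apply: vert_step.
have rb : blk r = b.
  apply/eqP/negPn/negP => /eqP rb; case/eqP: fl; apply: eq_lex_sign => r' r'b.
  by rewrite Eo //; apply/eqP => r'r; case: rb; rewrite -r'r.
have cm : corner F r = m.
  apply/eqP/negPn/negP => /eqP cm; case/eqP: fl; apply: eq_lex_sign => r' r'b.
  have [->|/Eo -> //] := eqVneq r' r.
  by rewrite Ev Ew; move: cm; rewrite /corner; case: (F.1.2 r); lia.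
split=> // r' r'b r'a; rewrite ltnNge leq_eqVlt; apply/negP => /orP[].
  rewrite val_eqE => /eqP /perm_inj rr'.
  by move: r'a; rewrite -rr' /r step_coordK ltnn.
(* Intervals have odd coordinates, whereas [M] is even. *)
move=> h; have v'M : vert F a r' != M.
  case: (F) r'a => [[y e] q] /= r'a; rewrite ffunE r'a; lia.
have [r1 [lr1 r1p]] := leading_exists p r'b v'M.
have hr1 := leq_trans h r1p.
have r1r : r1 != r by apply: contraTneq hr1 => ->; rewrite ltnn.
case/eqP: fl; rewrite (leading_sign x lr1).
have lr1' : leading p b (vert F a.+1) r1.
  move: lr1; rewrite /leading Eo // => /and3P[-> -> /forallP r1c] /=.
  apply/forallP => r2; move: (r1c r2); have [->|/Eo -> //] := eqVneq r2 r.
  by rewrite [(p r1 < p r)%N]ltnNge (ltnW hr1) /= implybT.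
by rewrite (leading_sign x lr1') Eo.
Qed.

Lemma m_ltM : (m < M)%N. Proof. by lia. Qed.

(** Starts at the centre of the grid and opens the coordinates upwards, [rho a] at step [a]. *)
Definition center_flag (rho : 'S_n) : flag :=
  ([ffun => Ordinal m_ltM], [ffun => false], (rho^-1)%g).

Lemma lex_sign_center (rho : 'S_n) (v : vertex) (a : 'I_n) :
  (forall r, blk r = blk (rho a) -> r != rho a -> (M <= v r)%N) ->
  (M < v (rho a))%N ->
  (forall r, blk r = blk (rho a) -> (a < (rho^-1)%g r)%N -> v r = M) ->
  lex_sign (rho^-1)%g (rho a) (blk (rho a)) v.
Proof.
move=> vM va vc; have l : leading (rho^-1)%g (blk (rho a)) v (rho a).
  rewrite /leading eqxx neq_ltn va orbT /=; apply/forallP => r'; apply/implyP.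
  by move=> /eqP r'b; apply/implyP; rewrite permK => h; rewrite vc.
by rewrite (leading_sign _ l) eqxx.
Qed.

Lemma lex_signN_center (rho : 'S_n) (v : vertex) (a : 'I_n) :
  (forall r, blk r = blk (rho a) -> (M <= v r)%N) -> v (rho a) = M ->
  lex_sign (rho^-1)%g (rho a) (blk (rho a)) v = false.
Proof.
move=> vM va; apply/negbTE/negP => /lex_signP [r [/and3P[/eqP rb rM _]]].
case: eqP => [rE|_]; first by rewrite rE va eqxx in rM.
by rewrite ltnNge vM.
Qed.

Definition flips (rho : 'S_n) (F : flag) (a : 'I_n) :=
  lex_sign (rho^-1)%g (rho a) (blk (rho a)) (vert F a) !=
  lex_sign (rho^-1)%g (rho a) (blk (rho a)) (vert F a.+1).

Lemma flips_center_flag (rho : 'S_n) (a : 'I_n) : flips rho (center_flag rho) a.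
Proof.
rewrite /flips lex_signN_center ?lex_sign_center // => [r rb rN||r rb h|r rb|].
- by rewrite !ffunE /=; case: ifP => _; lia.
- by rewrite !ffunE permK ltnSn /=; lia.
- by rewrite !ffunE ltnS leqNgt h /= addn0.
- by rewrite !ffunE /=; case: ifP => _; lia.
- by rewrite !ffunE permK ltnn /= addn0.
Qed.

(** By [lex_sign_step] all corners are central and each block opens in the order of [rho], so
    [perm_monotone_fibers] determines the permutation; the sign adapted to [rho a] forces that
    coordinate to open upwards. *)
Lemma flips_uniq (rho : 'S_n) (F : flag) :
  (forall a, flips rho F a) -> F = center_flag rho.
Proof.
move=> fl.
have st a := lex_sign_step (fl a).
have sK x : step_coord F (F.2 x) = x by rewrite /step_coord permK.
have pE : F.2 = (rho^-1)%g.
  suff : (rho * F.2)%g = 1%g by move=> /(canRL (mulKg _)); rewrite mulg1.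
  apply: (@perm_monotone_fibers n _ (fun a => blk (rho a))) => [a|a b ab ltab].
    by rewrite permM; have [<- _ _] := st (F.2 (rho a)); rewrite sK.
  rewrite !permM ltnNge leq_eqVlt; apply/negP => /orP[].
    by move=> /eqP/val_inj/perm_inj/perm_inj E; rewrite E ltnn in ltab.
  move=> h; have [+ _ /(_ (rho b))] := st (F.2 (rho a)); rewrite sK => <-.
  by rewrite -ab => /(_ erefl h); rewrite !permK ltnNge ltnW.
have sE a : step_coord F a = rho a by rewrite /step_coord pE invgK.
have cE r : corner F r = m.
  by have [_ + _] := st (rho^-1 r)%g; rewrite sE permKV.
have vE r j : vert F j r = if ((rho^-1)%g r < j)%N then (F.1.1 r).*2.+1 else M.
  move: (cE r) pE; case: (F) => [[y e] p] /=; rewrite /corner /= => cr ->.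
  by rewrite ffunE cr.
(* Induction on the step: the coordinates opened earlier lie above the centre, so the sign is
   negative before the step and becomes positive only if [rho a] rises. *)
have e0 r : F.1.2 r = false.
  rewrite -[r](permKV rho); move: ((rho^-1)%g r) => a.
  have [l] := ubnP a; elim: l a => // l IH a; rewrite ltnS => al.
  have vM r' : r' != rho a -> (M <= vert F a r')%N /\ (M <= vert F a.+1 r')%N.
    move=> r'a; have r'a' : (rho^-1)%g r' != a.
      by apply: contra r'a => /eqP <-; rewrite permKV.
    have h : ((rho^-1)%g r' < a.+1)%N = ((rho^-1)%g r' < a)%N.
      by rewrite ltnS leq_eqVlt val_eqE (negbTE r'a').
    rewrite !vE h; case: ifP => // ra.
    have := IH ((rho^-1)%g r') (leq_trans ra al); rewrite permKV => er'.
    by move: (cE r'); rewrite /corner er'; lia.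
  have va : vert F a (rho a) = M by rewrite vE permK ltnn.
  have := fl a; rewrite /flips lex_signN_center //; last first.
    by move=> r' _; have [->|/vM[]//] := eqVneq r' (rho a); rewrite va.
  rewrite eq_sym eqbF_neg negbK => /lex_signP [r' [_]].
  have [->|/vM[_]] := eqVneq r' (rho a); last by rewrite leqNgt => /negbTE ->.
  rewrite vE permK ltnSn; move: (cE (rho a)); rewrite /corner.
  by case: (F.1.2 _) => //=; lia.
move: pE e0 cE; case: (F) => [[y e] p] /=; rewrite /center_flag /corner /= => -> e0 cE.
congr (_, _, _); apply/ffunP => r; rewrite !ffunE //; apply/val_inj => /=.
by move: (cE r); rewrite e0 addn0.
Qed.

Definition is_balanced (f : 'I_n -> 'I_k) : bool := [exists rho : 'S_n,
  [forall a, f a == blk (rho a)]].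

Definition block_sign (b : 'I_k) (v : vertex) : 'F_2 :=
  (lex_sign 1%g (Ordinal n_gt0) b v)%:R.

Lemma F2_bool_add (c d : bool) : c%:R + d%:R = (c != d)%:R :> 'F_2.
Proof. by case: c; case: d; apply/val_inj. Qed.

Lemma if_bool_F2 (c : bool) : c%:R = (if c then 1 else 0) :> 'F_2.
Proof. by case: c. Qed.

Lemma F2_bool_addN (c d : bool) : (c%:R + d%:R != 0 :> 'F_2) = (c != d).
Proof. by rewrite F2_bool_add; case: c; case: d. Qed.

(** For a balanced [f], the signs may be replaced by those adapted to [rho], which have the same
    symmetries and for which only [center_flag rho] contributes. Otherwise no flag contributes,
    since its order of steps would balance [f]. *)
Lemma flag_sum_block_sign (f : nat -> 'I_k) :
  flag_sum M (mkseq (fun a => block_sign (f a)) n) =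
  (is_balanced (fun a => f a))%:R.
Proof.
case: (boolP (is_balanced _)) => [/existsP [rho /forallP frho]|nb].
  pose s a : vertex -> 'F_2 := if insub a is Some x then
    fun v => (lex_sign (rho^-1)%g (rho x) (blk (rho x)) v)%:R else fun=> 0.
  rewrite (@flag_sum_indep n k M blk n_gt0 _ (fun a => [set f a]) _ s).
  - rewrite /flag_sum (bigD1 (center_flag rho)) //= [X in _ + X]big1 ?addr0.
      rewrite cup_prod big1 // => a _; rewrite /s valK F2_bool_add.
      by have := flips_center_flag rho a; rewrite /flips => ->.
    move=> F; apply: contraNeq; rewrite cup_prod => /prodf_neq0 H.
    apply/eqP/flips_uniq => a; have := H a isT.
    by rewrite /s valK F2_bool_addN.
  - by rewrite double_gt0.
  - by move=> a _; apply: lex_sign_equivariant.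
  - move=> a an; rewrite /s insubT /= (eqP (frho (Ordinal an))).
    exact: lex_sign_equivariant.
rewrite /flag_sum big1 // => F _; apply/eqP; apply: contraNT nb.
rewrite cup_prod => /prodf_neq0 H; apply/existsP; exists (F.2^-1)%g.
apply/forallP => a; have := H a isT; rewrite F2_bool_addN => h.
by have [<- _ _] := lex_sign_step h.
Qed.

Lemma block_sign_equivariant (A : {set 'I_k}) :
  equivariant M blk A (fun v => \sum_(i in A) block_sign i v).
Proof.
move=> j v vb.
have E i : block_sign i (antipode M blk j v) = block_sign i v + (j == i)%:R.
  by rewrite [LHS](lex_sign_equivariant _ _ _ vb) inE.
under eq_bigr do rewrite E.
rewrite big_split; congr (_ + _) => /=.
have [jA|jA] := boolP (j \in A).
  rewrite (bigD1 j) //= eqxx big1 ?addr0 // => i /andP[_ /negbTE].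
  by rewrite eq_sym => ->.
by rewrite big1 // => i iA; case: eqP => // ji; rewrite ji iA in jA.
Qed.

(** Each [s a] may be replaced by the sum of the block signs over [A a]; expanding the product
    leaves one flag sum for each choice [f] of blocks. *)
Lemma flag_sum_count (A : 'I_n -> {set 'I_k}) (s : 'I_n -> vertex -> 'F_2) :
  (forall a, equivariant M blk (A a) (s a)) ->
  \sum_(F : flag) \prod_a (s a (vert F a) + s a (vert F a.+1)) =
  \sum_(f : {ffun 'I_n -> 'I_k} | [forall a, f a \in A a] && is_balanced f) 1.
Proof.
move=> sA.
pose x0 := Ordinal n_gt0; pose nat_ext T (g : 'I_n -> T) a := g (insubd x0 a).
have extE T (g : 'I_n -> T) (a : 'I_n) : nat_ext T g a = g a.
  by rewrite /nat_ext valKd.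
pose h a v := \sum_(i in A a) block_sign i v.
have sumE (g : 'I_n -> vertex -> 'F_2) :
    \sum_(F : flag) \prod_a (g a (vert F a) + g a (vert F a.+1)) =
    flag_sum M (mkseq (nat_ext _ g) n).
  rewrite /flag_sum; apply: eq_bigr => F _; rewrite cup_prod.
  by apply: eq_bigr => a _; rewrite extE.
rewrite sumE (@flag_sum_indep n k M blk n_gt0 _ (nat_ext _ A) _ (nat_ext _ h)) //.
- rewrite -sumE /h.
  under eq_bigr => F _.
    under eq_bigr do rewrite -big_split.
    rewrite bigA_distr_big_dep; over.
  rewrite exchange_big [in RHS]big_mkcondr /=; apply: eq_big => f.
    by apply/familyP/forallP.
  move=> _; rewrite (sumE (fun a => block_sign (f a))).
  have := flag_sum_block_sign (nat_ext _ f).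
  rewrite -if_bool_F2 /is_balanced.
  have -> : mkseq (nat_ext _ (fun a => block_sign (f a))) n =
    mkseq (fun a => block_sign (nat_ext _ f a)) n by [].
  move=> ->; congr (_%:R); congr nat_of_bool.
  by apply: eq_existsb => rho; apply: eq_forallb => a; rewrite extE.
- by rewrite double_gt0.
- by move=> a _; apply: sA.
- by move=> a _; apply: block_sign_equivariant.
Qed.
End FlagCount.

(** * Odd coefficients *)

Section MonomialCoefficients.
Import mpoly.
Variable k : nat.
Implicit Types (p q : {mpoly 'F_2[k]}) (E : 'X_{1..k}).

Lemma mcoeff_mul_neq0 p q E : (p * q)@_E != 0 ->
  exists E1 E2, [/\ E = (E1 + E2)%MM, p@_E1 != 0 & q@_E2 != 0].
Proof.
rewrite mcoeffM => H.
case: (boolP [exists c : 'X_{1..k < (mdeg E).+1, (mdeg E).+1},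
    (E == c.1 + c.2)%MM && (p@_c.1 * q@_c.2 != 0)]) => [/existsP[c]|].
  case/andP => /eqP Ec H'; exists c.1, c.2; split=> //.
    by apply: contraNneq H' => ->; rewrite mul0r.
  by apply: contraNneq H' => ->; rewrite mulr0.
move=> /existsPn H'; case/eqP: H; rewrite big1 // => c Ec.
by have := H' c; rewrite Ec negbK => /eqP.
Qed.

Lemma mcoeff_mulX p m E :
  (p * 'X_[m])@_E = if (m <= E)%MM then p@_(E - m) else 0.
Proof.
case: ifP => [mE|mE]; first by rewrite -{1}(submK mE) addmC mcoeffMX.
apply/eqP; apply: contraFT mE => /mcoeff_mul_neq0 [E1 [E2 [-> _]]].
by rewrite mcoeffX; case: (m =P E2) => [->|//] _; apply: lem_addl.
Qed.

Lemma mcoeff_prod_linear (C : finType) (A : C -> {set 'I_k}) E :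
  (\prod_c \sum_(i in A c) 'X_i : {mpoly 'F_2[k]})@_E =
  \sum_(f : {ffun C -> 'I_k} | [forall c, f c \in A c] &&
     [forall i, #|[set c | f c == i]| == E i]) 1.
Proof.
rewrite bigA_distr_big_dep raddf_sum [in RHS]big_mkcondr /=.
apply: eq_big => f; first by apply/familyP/forallP.
move=> _; rewrite -(big_morph _ (@mpolyXD _ _) (mpolyX0 _ _)) mcoeffX.
rewrite -if_bool_F2; congr (nat_of_bool _)%:R.
have S i : (\sum_c U_(f c))%MM i = #|[set c | f c == i]|.
  rewrite mnm_sumE -sum1_card big_mkcond [RHS]big_mkcond /=.
  by apply: eq_bigr => c _; rewrite mnm1E inE; case: eqP.
apply/eqP/forallP => [<- i|H]; first by rewrite S.
by apply/mnmP => i; rewrite S; apply/eqP.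
Qed.

End MonomialCoefficients.

(** * Powers of the Vandermonde product modulo 2 *)

Section Vandermonde2.
Import mpoly.
Variable k : nat.

Definition vandermonde2 : {mpoly 'F_2[k]} :=
  \prod_(i < k) \prod_(j < k | (i < j)%N) ('X_i + 'X_j).

Lemma mpoly2_oppr (p : {mpoly 'F_2[k]}) : - p = p.
Proof. by apply/mpolyP => m; rewrite mcoeffN F2_oppr. Qed.

Lemma mpoly2_addxx (p : {mpoly 'F_2[k]}) : p + p = 0.
Proof. by rewrite -{1}(mpoly2_oppr p) addNr. Qed.

Lemma mpoly2_sqrD (p q : {mpoly 'F_2[k]}) : (p + q) ^+ 2 = p ^+ 2 + q ^+ 2.
Proof. by rewrite sqrrD mulr2n mpoly2_addxx addr0. Qed.

Lemma mpoly2_exp2D (p q : {mpoly 'F_2[k]}) j :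
  (p + q) ^+ (2 ^ j) = p ^+ (2 ^ j) + q ^+ (2 ^ j).
Proof.
elim: j => [|j IH]; first by rewrite !expr1.
by rewrite expnSr !exprM IH mpoly2_sqrD.
Qed.

(** Squaring is additive, so the power is the Vandermonde product in the ['X_i ^+ (2 ^ j)]; its
    determinant expansion has no signs modulo 2. *)
Lemma vandermonde2_exp2 j : vandermonde2 ^+ (2 ^ j) =
  \sum_(s : 'S_k) 'X_[[multinom (2 ^ j * s i)%N | i < k]].
Proof.
pose a : 'rV[{mpoly 'F_2[k]}]_k := \row_i 'X_i ^+ (2 ^ j).
transitivity (\det (Vandermonde k a)).
  rewrite det_Vandermonde /vandermonde2 -prodrXl; apply: eq_bigr => i _.
  rewrite -prodrXl; apply: eq_bigr => l _.
  by rewrite !mxE mpoly2_exp2D mpoly2_oppr addrC.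
rewrite -det_tr /determinant; apply: eq_bigr => s _.
have -> : (-1) ^+ s = 1 :> {mpoly 'F_2[k]} by rewrite mpoly2_oppr expr1n.
rewrite mul1r mpolyXE_id; apply: eq_bigr => i _.
by rewrite !mxE mnmE exprM.
Qed.

End Vandermonde2.

Lemma sum_exp2 (R : nzRingType) q : \sum_(j < q) 2 ^+ j = 2 ^+ q - 1 :> R.
Proof. by have := subrX1 (2 : R) q; rewrite (_ : 2 - 1 = 1) ?mul1r // addrK. Qed.

(* The positive definite form [S] vanishes by the hypothesis, since power sums
   are invariant under permutations. *)
Lemma perm_tuple_uniq (k q : nat) (s : 'I_q.+1 -> 'S_k) : (0 < k)%N ->
  (forall i : 'I_k, \sum_(j < q.+1) 2 ^ j * s j i =
     (2 ^ q - 1) * (k - 1) + i)%N ->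
  s ord_max = 1%g /\
  forall (j : 'I_q) i, s (widen_ord (leqnSn q) j) i = rev_ord i.
Proof.
move=> k0 H.
pose a i : int := s ord_max i; pose b (j : 'I_q) i : int := s (widen_ord (leqnSn q) j) i.
pose c : int := k%:Z - 1; pose Qm : int := 2 ^+ q - 1.
pose id i : int := (i : 'I_k).
have psum (f : int -> int) j : \sum_i f (s j i)%:Z = \sum_i f (id i).
  by rewrite [RHS](reindex_inj (@perm_inj _ (s j))).
pose A : int := \sum_i id i; pose B : int := \sum_i (id i) ^+ 2.
have A2 : 2 * A = k%:Z * c.
  have : A = \sum_i (c - id i).
    rewrite /A (reindex_inj rev_ord_inj); apply: eq_bigr => i _.
    by rewrite /id /c /=; have := ltn_ord i; lia.
  by rewrite sumrB sumr_const card_ord -/A -mulr_natl natz; lia.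
have H' i : \sum_(j < q) 2 ^+ j * b j i = Qm * c + id i - 2 ^+ q * a i.
  have := congr1 (fun n => n%:R : int) (H i).
  rewrite big_ord_recr /= !natrD natr_sum !natrM !natrB ?expn_gt0 // !natrX.
  rewrite !natz => /(canRL (addrK _)) <-.
  by apply: eq_bigr => j _; rewrite natrM natrX !natz.
pose D := \sum_i a i * id i.
(* [S] measures the distance to the solution with the identity at [ord_max] and the reversal
   elsewhere. *)
pose S := \sum_i (a i - id i) ^+ 2 + \sum_(j < q) 2 ^+ j * \sum_i (a i + b j i - c) ^+ 2.
have aA : \sum_i a i = A := psum idfun ord_max.
have aB : \sum_i a i ^+ 2 = B := psum (fun x => x ^+ 2) ord_max.
have bA j : \sum_i b j i = A := psum idfun _.
have bB j : \sum_i b j i ^+ 2 = B := psum (fun x => x ^+ 2) _.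
have S1 : \sum_i (a i - id i) ^+ 2 = 2 * B - 2 * D.
  transitivity (\sum_i (a i ^+ 2 + id i ^+ 2 - 2 * (a i * id i))).
    by apply: eq_bigr => i _; ring.
  by rewrite sumrB big_split -mulr_sumr /= aB -/B -/D; ring.
have S2 j : \sum_i (a i + b j i - c) ^+ 2 =
    (2 * B + k%:Z * c ^+ 2 - 4 * c * A) + 2 * \sum_i a i * b j i.
  transitivity (\sum_i (a i ^+ 2 + b j i ^+ 2 + c ^+ 2 + 2 * (a i * b j i)
     - (2 * c * a i + 2 * c * b j i))).
    by apply: eq_bigr => i _; ring.
  rewrite sumrB !big_split -!mulr_sumr /= aB bB aA bA.
  by rewrite sumr_const card_ord -mulr_natl natz; ring.
have S3 : \sum_(j < q) 2 ^+ j * \sum_i a i * b j i = Qm * c * A + D - 2 ^+ q * B.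
  under eq_bigr do rewrite mulr_sumr.
  rewrite exchange_big /=.
  transitivity (\sum_i (Qm * c * a i + a i * id i - 2 ^+ q * a i ^+ 2)).
    apply: eq_bigr => i _; under eq_bigr do rewrite mulrCA.
    by rewrite -mulr_sumr H'; ring.
  by rewrite sumrB !big_split -!mulr_sumr /= aB aA.
have S0 : S = 0.
  rewrite /S S1.
  rewrite (eq_bigr (fun j : 'I_q => 2 ^+ j * (2 * B + k%:Z * c ^+ 2 - 4 * c * A) +
    2 * (2 ^+ j * \sum_i a i * b j i))); last by move=> j _; rewrite S2; ring.
  rewrite big_split /= -mulr_suml -mulr_sumr S3 sum_exp2 -/Qm.
  have -> : 2 ^+ q = Qm + 1 by rewrite subrK.
  have -> : k%:Z * c ^+ 2 = 2 * A * c by rewrite A2; ring.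
  by ring.
have sq0 (f : 'I_k -> int) : 0 <= \sum_i f i ^+ 2 by apply: sumr_ge0 => i _; apply: sqr_ge0.
have S2ge : 0 <= \sum_(j < q) 2 ^+ j * \sum_i (a i + b j i - c) ^+ 2.
  by apply: sumr_ge0 => j _; rewrite mulr_ge0 // exprn_ge0.
move/eqP: S0; rewrite paddr_eq0 // => /andP[/eqP Z1 /eqP Z2].
have sqE (f : 'I_k -> int) : \sum_i f i ^+ 2 = 0 -> forall i, f i = 0.
  move=> f0 i; apply/eqP; rewrite -sqrf_eq0; apply/eqP.
  by apply: (psumr_eq0P _ f0) => // l _; apply: sqr_ge0.
have ai := sqE _ Z1.
have bi (j : 'I_q) : forall i, a i + b j i - c = 0.
  apply: sqE; apply/eqP; have : 2 ^+ j * \sum_i (a i + b j i - c) ^+ 2 == 0.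
    apply/eqP; apply: (psumr_eq0P _ Z2) => // l _.
    by rewrite mulr_ge0 // exprn_ge0.
  by rewrite mulf_eq0 expf_eq0 /= andbF.
split=> [|j i]; last first.
  apply/val_inj => /=; have := bi j i; have := ai i; have := ltn_ord i.
  by rewrite /a /b /id /c; lia.
apply/permP => i; rewrite perm1; apply/val_inj.
by have := ai i; rewrite /a /id /=; lia.
Qed.

(** * The odd coefficient for pairs *)

Section PairCoefficient.
Import mpoly.
Variable k : nat.
Hypothesis k_gt0 : (0 < k)%N.

(** The exponent given by the identity at weight [2 ^ q] and the reversal at each lower weight; its
    entries are at most [2 ^ q * (k - 1)]. *)
Definition vdm_exponent q : 'X_{1..k} :=
  [multinom ((2 ^ q - 1) * (k - 1) + i)%N | i < k].

Lemma sum_exp2_nat q : (\sum_(j < q) 2 ^ j = 2 ^ q - 1)%N.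
Proof. by rewrite subn1 predn_exp mul1n. Qed.

(** The binary expansion of [2 ^ q.+1 - 1] makes the power a sum over tuples of permutations, of
    which [perm_tuple_uniq] leaves exactly one. *)
Lemma vandermonde2_exp q :
  (vandermonde2 k ^+ (2 ^ q.+1 - 1))@_(vdm_exponent q) = 1.
Proof.
rewrite -sum_exp2_nat -prodrXr.
under eq_bigr do rewrite vandermonde2_exp2.
rewrite bigA_distr_bigA raddf_sum /=.
pose s0 : {ffun 'I_q.+1 -> 'S_k} :=
  [ffun j => if j == ord_max then 1%g else perm rev_ord_inj].
have co (s : {ffun 'I_q.+1 -> 'S_k}) :
    (\prod_(j < q.+1) 'X_[[multinom (2 ^ j * s j i)%N | i < k]] :
      {mpoly 'F_2[k]})@_(vdm_exponent q) =
    [forall i : 'I_k, \sum_(j < q.+1) 2 ^ j * s j i ==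
       (2 ^ q - 1) * (k - 1) + i]%:R%N.
  rewrite -(big_morph _ (@mpolyXD _ _) (mpolyX0 _ _)) mcoeffX.
  congr (nat_of_bool _)%:R; apply/eqP/forallP => [E i|E].
    have := congr1 (fun m : 'X_{1..k} => m i) E.
    rewrite mnm_sumE mnmE => <-; apply/eqP.
    by apply: eq_bigr => j _; rewrite mnmE.
  apply/mnmP => i; rewrite mnm_sumE mnmE -(eqP (E i)).
  by apply: eq_bigr => j _; rewrite mnmE.
rewrite (bigD1 s0) //= [X in _ + X]big1 ?addr0.
  rewrite co (_ : [forall i, _]) //; apply/forallP => i.
  rewrite big_ord_recr /= ffunE eqxx perm1.
  under eq_bigr => j _.
    rewrite ffunE ifF; last by rewrite -val_eqE /=; have := ltn_ord j; lia.
    rewrite permE /=; over.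
  rewrite -big_distrl /= sum_exp2_nat.
  have := expn_gt0 2 q; have := ltn_ord i; set Q := (2 ^ q)%N.
  move=> ik Q0; have -> : (k - 1 = (k - i.+1) + i)%N by lia.
  by case: Q Q0 => // Q' _; apply/eqP; lia.
move=> s; rewrite co; apply: contraNeq; rewrite if_bool_F2.
case: forallP => // H _; have [h1 h2] := perm_tuple_uniq k_gt0 (fun i => eqP (H i)).
apply/eqP/ffunP => j; rewrite ffunE; case: eqP => [-> //|jq].
have jq' : (j < q)%N.
  have := ltn_ord j; have : val j <> q by move=> E; apply: jq; apply/val_inj.
  by rewrite /=; lia.
apply/permP => i; rewrite permE -(h2 (Ordinal jq')).
by congr (s _ i); apply/val_inj.
Qed.

(** Removing the factor of power [t - 1] from the power [2 ^ q.+1 - 1] can only lower the exponents;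
    the singletons then add [2 ^ q.+1 - t] to each. *)
Lemma pair_coefficient q t : (1 <= t <= 2 ^ q)%N ->
  exists2 E : 'X_{1..k}, (forall i, E i <= 2 ^ q * (k + 1) - t)%N &
    (((\prod_i 'X_i) * vandermonde2 k) ^+ (2 ^ q.+1 - t))@_E != 0.
Proof.
move=> /andP[t1 t2].
have E1 : (2 ^ q.+1 - 1 = (2 ^ q.+1 - t) + (t - 1))%N by rewrite expnS; lia.
have := vandermonde2_exp q; rewrite E1 exprD => H.
have {}H : (vandermonde2 k ^+ (2 ^ q.+1 - t) * vandermonde2 k ^+ (t - 1))@_(vdm_exponent q) != 0.
  by rewrite H.
have [F1 [F2 [EF H1 _]]] := mcoeff_mul_neq0 H.
exists (F1 + [multinom 2 ^ q.+1 - t | i < k])%MM.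
  move=> i; rewrite mnmDE mnmE.
  have : (F1 i <= vdm_exponent q i)%N by rewrite EF mnmDE leq_addr.
  rewrite mnmE expnS; have := ltn_ord i; move: t2; set Q := (2 ^ q)%N; nia.
rewrite exprMn mulrC.
have -> : (\prod_i 'X_i : {mpoly 'F_2[k]}) ^+ (2 ^ q.+1 - t) =
    'X_[[multinom 2 ^ q.+1 - t | i < k]].
  by rewrite mpolyXE_id -prodrXl; apply: eq_bigr => i _; rewrite mnmE.
by rewrite addmC mcoeffMX.
Qed.
End PairCoefficient.

(** * The Cartier operator in characteristic 2 *)

Section CartierOperator.
Import mpoly.
Variable k : nat.
Implicit Types (p h : {mpoly 'F_2[k]}) (E : 'X_{1..k}).

Definition odd_exp E : 'X_{1..k} := [multinom (E i).*2.+1 | i < k].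

(** Sends the monomial of exponent [odd_exp E] to that of exponent [E] and all other monomials to
    zero. The bound on the degree loses nothing, because [odd_exp] does not lower it. *)
Definition cartier p : {mpoly 'F_2[k]} :=
  \sum_(E : 'X_{1..k < msize p}) p@_(odd_exp E) *: 'X_[E].

Lemma cartierE p E : (cartier p)@_E = p@_(odd_exp E).
Proof.
have [lt|ge] := ltnP (mdeg E) (msize p).
  by rewrite /cartier (mcoeff_mpoly (fun E => p@_(odd_exp E))).
have dE : (mdeg E <= mdeg (odd_exp E))%N.
  by rewrite !mdegE; apply: leq_sum => i _; rewrite mnmE; lia.
rewrite [RHS]memN_msupp_eq0; last first.
  by apply/negP => /msize_mdeg_lt; rewrite ltnNge (leq_trans ge dE).
rewrite /cartier raddf_sum big1 // => -[F lt] _ /=.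
rewrite mcoeffZ mcoeffX; case: eqP => [EF|_]; last by rewrite mulr0.
by move: lt ge; rewrite EF ltnNge => /negbTE ->.
Qed.

Lemma F2_sqr (c : 'F_2) : c ^+ 2 = c.
Proof. by case: c => [[|[|?]] ?] //; apply/val_inj. Qed.

Lemma sqr_monomial (c : 'F_2) E :
  (c *: 'X_[E] : {mpoly 'F_2[k]}) ^+ 2 = c *: 'X_[E + E].
Proof. by rewrite exprZn F2_sqr expr2 -mpolyXD. Qed.

Lemma mcoeff_sqr_even p E : (p ^+ 2)@_(E + E) = p@_E.
Proof.
elim/mpolyind: p E => [|c m p _ _ IH] E; first by rewrite expr2 mul0r !mcoeff0.
rewrite mpoly2_sqrD !mcoeffD IH sqr_monomial !mcoeffZ !mcoeffX.
congr (_ * _%:R + _); congr nat_of_bool; apply/eqP/eqP => [|-> //].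
by move=> H; apply/mnmP => i; move/mnmP: H => /(_ i); rewrite !mnmDE; lia.
Qed.

(** Projection formula: a square leaves [cartier] as its root. Since squaring is additive, it
    suffices to treat monomials [h]. *)
Lemma mcoeff_sqr_odd h p E : (h ^+ 2 * p)@_(odd_exp E) = (h * cartier p)@_E.
Proof.
elim/mpolyind: h E => [|c m h _ _ IH] E; first by rewrite expr2 !mul0r !mcoeff0.
rewrite mpoly2_sqrD !mulrDl !mcoeffD IH sqr_monomial -!scalerAl !mcoeffZ.
congr (_ * _ + _); rewrite ![_ * p]mulrC ![_ * cartier p]mulrC !mcoeff_mulX.
have -> : (m + m <= odd_exp E)%MM = (m <= E)%MM.
  apply/mnm_lepP/mnm_lepP => H i; move: (H i); rewrite mnmDE mnmE; lia.
case: ifP => // /mnm_lepP H; rewrite cartierE; congr (_@_ _).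
by apply/mnmP => i; move: (H i); rewrite !(mnmE, mnmBE, mnmDE); lia.
Qed.
End CartierOperator.

(** * Computing with polynomials modulo 2 as lists of exponents *)

Section ListPolynomials.
Import mpoly.
Variable k : nat.

Definition seq_mnm (s : seq nat) : 'X_{1..k} := [multinom nth 0 s i | i < k].

Definition seq_mpoly (L : seq (seq nat)) : {mpoly 'F_2[k]} :=
  \sum_(s <- L) 'X_[seq_mnm s].

(** Addition of a monomial modulo 2: an equal one already present cancels with it. *)
Definition xor_insert (s : seq nat) L := if s \in L then rem s L else s :: L.

Definition xor_reduce (L : seq (seq nat)) := foldr xor_insert [::] L.

Lemma seq_mpoly_reduce L : seq_mpoly (xor_reduce L) = seq_mpoly L.
Proof.
elim: L => //= s L IH; rewrite {2}/seq_mpoly big_cons -/(seq_mpoly L) -IH.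
move: (xor_reduce L) => {IH}L; rewrite /seq_mpoly /xor_insert.
case: ifP => [sL|_]; last by rewrite big_cons.
by rewrite (perm_big _ (perm_to_rem sL)) big_cons addrA mpoly2_addxx add0r.
Qed.

Definition seq_add (s t : seq nat) := mkseq (fun i => nth 0 s i + nth 0 t i)%N k.

Definition seq_mul (L1 L2 : seq (seq nat)) :=
  [seq seq_add s t | s <- L1, t <- L2].

Lemma seq_mpoly_mul L1 L2 :
  seq_mpoly (seq_mul L1 L2) = seq_mpoly L1 * seq_mpoly L2.
Proof.
rewrite /seq_mpoly big_allpairs_dep /= mulr_suml; apply: eq_bigr => s _.
rewrite mulr_sumr; apply: eq_bigr => t _; rewrite -mpolyXD; congr 'X_[_].
by apply/mnmP => i; rewrite mnmDE !mnmE nth_mkseq.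
Qed.

Definition trunc N L := [seq s <- L | all (fun x => x < N)%N (take k s)].

Lemma mcoeff_trunc N L (E : 'X_{1..k}) : (forall i, E i < N)%N ->
  (seq_mpoly (trunc N L))@_E = (seq_mpoly L)@_E.
Proof.
move=> EN; rewrite /seq_mpoly big_filter !raddf_sum big_mkcond.
apply: eq_bigr => s _; case: ifP => //.
move=> /negbT /allPn [x /(nthP 0)[j]]; rewrite size_take_min => js <-.
rewrite nth_take /=; last by lia.
rewrite mcoeffX.
have jk : (j < k)%N by lia.
case: (seq_mnm s =P E) => [sE /negP[]|_ _] //.
by have := EN (Ordinal jk); rewrite -sE mnmE.
Qed.
End ListPolynomials.

Lemma sum_indicator_F2 (T : eqType) (L : seq T) x : uniq L -> x \in L ->
  \sum_(s <- L) (s == x)%:R = 1 :> 'F_2.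
Proof.
move=> u m; rewrite (bigD1_seq _ m u) /= eqxx big1 ?addr0 //.
by move=> s /negbTE ->.
Qed.

(** * The odd coefficient for triples among four hyperplanes *)

Section TripleCoefficient.
Import mpoly.
Local Notation poly4 := {mpoly 'F_2[4]}.

(** The product of the linear forms of all pairs and all triples of four indices, a triple being the
    complement of one index. *)
Definition pair_triple_form : poly4 :=
  vandermonde2 4 * \prod_i \sum_(j | j != i) 'X_j.

Definition unit_seq (i : nat) : seq nat := mkseq (fun j => (i == j) : nat) 4.

Definition lin_seq (s : seq nat) : seq (seq nat) := map unit_seq s.

Definition pair_triple_forms : seq (seq nat) :=
  [:: [:: 0; 1]; [:: 0; 2]; [:: 0; 3]; [:: 1; 2]; [:: 1; 3]; [:: 2; 3];
      [:: 1; 2; 3]; [:: 0; 2; 3]; [:: 0; 1; 3]; [:: 0; 1; 2]]%N.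

Definition pair_triple_list : seq (seq nat) :=
  foldr (fun s L => xor_reduce (seq_mul 4 (lin_seq s) L)) [:: nseq 4 0] pair_triple_forms.

Lemma pair_triple_formE : pair_triple_form = seq_mpoly 4 pair_triple_list.
Proof.
have X (i : 'I_4) : 'X_i = 'X_[seq_mnm 4 (unit_seq i)] :> poly4.
  congr 'X_[_]; apply/mnmP => j; rewrite mnm1E mnmE nth_mkseq //.
have E : seq_mpoly 4 pair_triple_list = \prod_(s <- pair_triple_forms) seq_mpoly 4 (lin_seq s).
  rewrite /pair_triple_list; elim: pair_triple_forms => [|s L IH] /=.
    rewrite big_nil /seq_mpoly big_seq1 -[RHS]mpolyX0; congr 'X_[_].
    by apply/mnmP; case=> -[|[|[|[|]]]] // i; rewrite mnmE mnm0E.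
  by rewrite big_cons -IH seq_mpoly_reduce seq_mpoly_mul.
rewrite E /pair_triple_forms !big_cons big_nil mulr1 /lin_seq /seq_mpoly /= !big_cons !big_nil !addr0.
rewrite /pair_triple_form /vandermonde2 !big_ord_recl !big_ord0 !mulr1.
pose o1 : 'I_4 := lift ord0 ord0; pose o2 : 'I_4 := lift ord0 (lift ord0 ord0).
pose o3 : 'I_4 := lift ord0 (lift ord0 (lift ord0 ord0)).
have P4 (P : pred 'I_4) (F : 'I_4 -> poly4) : \prod_(j | P j) F j =
    (if P ord0 then F ord0 else 1) * ((if P o1 then F o1 else 1) *
    ((if P o2 then F o2 else 1) * (if P o3 then F o3 else 1))).
  by rewrite big_mkcond !big_ord_recl big_ord0 /= mulr1.
have S4 (P : pred 'I_4) (F : 'I_4 -> poly4) : \sum_(j | P j) F j =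
    (if P ord0 then F ord0 else 0) + ((if P o1 then F o1 else 0) +
    ((if P o2 then F o2 else 0) + (if P o3 then F o3 else 0))).
  by rewrite big_mkcond !big_ord_recl big_ord0 /= addr0.
rewrite !P4 !S4 /= !X /= /bump /= !mul1r !mulr1.
move: 'X_[seq_mnm 4 (unit_seq 0)] 'X_[seq_mnm 4 (unit_seq 1)] => x y.
move: 'X_[seq_mnm 4 (unit_seq 2)] 'X_[seq_mnm 4 (unit_seq 3)] => z t.
by rewrite !add0r !addr0 -!mulrA.
Qed.

(** The cube as the square times the form, where squaring doubles the exponents. *)
Definition cube_list : seq (seq nat) :=
  trunc 4 10 (seq_mul 4 (map (fun s => seq_add 4 s s) pair_triple_list) pair_triple_list).

Definition shift_list : seq (seq nat) :=
  trunc 4 10 (seq_mul 4 pair_triple_list [:: nseq 4 5]).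

Lemma pair_triple_list_cube : xor_reduce (cube_list ++ shift_list) = [::].
Proof. by vm_compute. Qed.

Definition const_mnm (c : nat) : 'X_{1..4} := [multinom c | _ < 4].

(** Rests on the computation [pair_triple_list_cube]; the descent only meets exponents up to 5 + 4 =
    9. *)
Lemma pair_triple_form_cube (E : 'X_{1..4}) : (forall i, E i < 10)%N ->
  (pair_triple_form ^+ 3)@_E = (pair_triple_form * 'X_[const_mnm 5])@_E.
Proof.
move=> E10.
have sq L : seq_mpoly 4 (map (fun s => seq_add 4 s s) L) = seq_mpoly 4 L ^+ 2.
  rewrite /seq_mpoly big_map; elim: L => [|s L IH].
    by rewrite !big_nil expr2 mul0r.
  rewrite !big_cons mpoly2_sqrD IH; congr (_ + _).
  rewrite expr2 -mpolyXD; congr 'X_[_].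
  by apply/mnmP => i; rewrite mnmDE !mnmE nth_mkseq.
have x5 : seq_mpoly 4 [:: nseq 4 5] = 'X_[const_mnm 5].
  rewrite /seq_mpoly big_seq1; congr 'X_[_].
  by apply/mnmP => i; rewrite !mnmE nth_nseq ltn_ord.
have E1 : (pair_triple_form ^+ 3)@_E = (seq_mpoly 4 cube_list)@_E.
  by rewrite mcoeff_trunc // seq_mpoly_mul sq -pair_triple_formE -exprSr.
have E2 : (pair_triple_form * 'X_[const_mnm 5])@_E = (seq_mpoly 4 shift_list)@_E.
  by rewrite mcoeff_trunc // seq_mpoly_mul x5 -pair_triple_formE.
apply/eqP; rewrite -subr_eq0 F2_oppr E1 E2 -mcoeffD /seq_mpoly -big_cat.
by rewrite -/(seq_mpoly 4 (cube_list ++ shift_list)) -seq_mpoly_reduce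
  pair_triple_list_cube /seq_mpoly big_nil mcoeff0.
Qed.

Definition staircase : 'X_{1..4} := [multinom val i | i < 4].

(* By [pair_triple_form_cube] the top coefficient of [twist n] times the form is
   the same for all [n], so the descent below can start at any [n]. *)
Fixpoint twist n : poly4 :=
  if n is n'.+1 then cartier (twist n' * pair_triple_form) else 'X_[staircase].

Lemma twist_coeff n : (twist n * pair_triple_form)@_(const_mnm 4) = 1.
Proof.
elim: n => [|n IH].
  (* [staircase] complements the exponent (4, 3, 2, 1), at which the form has coefficient 1. *)
  have E : const_mnm 4 = (staircase + seq_mnm 4 [:: 4; 3; 2; 1]%N)%MM.
    by apply/mnmP; case=> -[|[|[|[|]]]] // i; rewrite mnmDE !mnmE.
  rewrite /= mulrC E mcoeffMX pair_triple_formE /seq_mpoly raddf_sum /=.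
  have F s : s \in pair_triple_list -> ('X_[seq_mnm 4 s] : poly4)@_(seq_mnm 4 [:: 4; 3; 2; 1]%N) =
      (s == [:: 4; 3; 2; 1]%N)%:R.
    move=> /(allP (_ : all (fun s => size s == 4) pair_triple_list)) H.
    have {H} /eqP sz : size s == 4%N by apply: H; vm_compute.
    rewrite mcoeffX; congr (nat_of_bool _)%:R; apply/eqP/eqP => [H|-> //].
    apply: (@eq_from_nth _ 0%N) => [|i]; rewrite sz // => i4.
    by have := congr1 (fun m : 'X_{1..4} => m (Ordinal i4)) H; rewrite !mnmE.
  rewrite big_seq (eq_bigr _ F) -big_seq.
  have u : uniq pair_triple_list by vm_compute.
  have m : [:: 4; 3; 2; 1]%N \in pair_triple_list by vm_compute.
  exact: sum_indicator_F2.
(* Moving the form into [cartier] squares it and completes a cube, while the exponent 4 becomes 9 =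
   5 + 4; reducing the cube splits off the monomial of exponent 5. *)
rewrite /= mulrC -mcoeff_sqr_odd mulrC -mulrA -exprS.
rewrite -IH; have -> : odd_exp (const_mnm 4) = (const_mnm 5 + const_mnm 4)%MM.
  by apply/mnmP => i; rewrite mnmDE !mnmE.
rewrite -[RHS](mcoeffMX _ (const_mnm 5)) -mulrA !mcoeffM; apply: eq_bigr => -[E1 E2] /= /eqP E.
congr (_ * _); apply: pair_triple_form_cube => i.
by have := congr1 (fun m : 'X_{1..4} => m i) E; rewrite !mnmDE !mnmE; lia.
Qed.

(* Squaring the multiplier doubles [t]; for odd [t] one factor of the form is left
   over and is absorbed by the next [twist]. *)
Lemma twist_descent q n t : (1 <= t <= 2 ^ q)%N -> exists h : poly4,
  (h * twist n * pair_triple_form ^+ (2 ^ q.+1 - t))@_(const_mnm (5 * 2 ^ q - t)) != 0.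
Proof.
elim: q n t => [|q IH] n t /andP[t1 t2].
  have -> : t = 1%N by lia.
  by exists 1; rewrite mul1r expr1 twist_coeff.
(* [t'] is half of [t], rounded up. *)
have [t' tE] : exists t', t = t'.*2 \/ t = t'.*2.-1.
  by exists (uphalf t); rewrite uphalf_half; have := odd_double_half t; case: odd; lia.
have t'q : (1 <= t' <= 2 ^ q)%N by move: t2; rewrite expnS; lia.
have K : (2 ^ q.+2 = (2 ^ q.+1).*2)%N by rewrite expnS mul2n.
have K' : (2 ^ q.+1 = (2 ^ q).*2)%N by rewrite expnS mul2n.
case: tE => tE.
  (* For even [t] the extra [twist n] in the multiplier completes a square. *)
  have [h H] := IH n t' t'q; exists (h ^+ 2 * twist n).
  have -> : h ^+ 2 * twist n * twist n * pair_triple_form ^+ (2 ^ q.+2 - t) =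
      (h * twist n * pair_triple_form ^+ (2 ^ q.+1 - t')) ^+ 2.
    have -> : (2 ^ q.+2 - t = (2 ^ q.+1 - t') * 2)%N by lia.
    by rewrite exprM; move: (_ ^+ (_ - _)) => z; ring.
  have -> : const_mnm (5 * 2 ^ q.+1 - t) =
      (const_mnm (5 * 2 ^ q - t') + const_mnm (5 * 2 ^ q - t'))%MM.
    by apply/mnmP => i; rewrite mnmDE !mnmE; lia.
  by rewrite mcoeff_sqr_even.
have [h H] := IH n.+1 t' t'q; exists (h ^+ 2).
have -> : h ^+ 2 * twist n * pair_triple_form ^+ (2 ^ q.+2 - t) =
    (h * pair_triple_form ^+ (2 ^ q.+1 - t')) ^+ 2 * (twist n * pair_triple_form).
  have -> : (2 ^ q.+2 - t = ((2 ^ q.+1 - t') * 2).+1)%N by lia.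
  by rewrite (exprS _ (_ * 2)) exprM; move: (_ ^+ (_ - _)) => z; ring.
have -> : const_mnm (5 * 2 ^ q.+1 - t) = odd_exp (const_mnm (5 * 2 ^ q - t')).
  by apply/mnmP => i; rewrite !mnmE; lia.
by rewrite mcoeff_sqr_odd -mulrA [_ * cartier _]mulrC mulrA.
Qed.

(** Removing the multiplier of [twist_descent] leaves exponents at most [5 * 2 ^ q - t], and the
    singletons add [2 ^ q.+1 - t]. *)
Lemma triple_coefficient q t : (1 <= t <= 2 ^ q)%N ->
  exists2 E : 'X_{1..4}, (forall i, E i <= 7 * 2 ^ q - 2 * t)%N &
    (((\prod_i 'X_i) * pair_triple_form) ^+ (2 ^ q.+1 - t))@_E != 0.
Proof.
move=> tq; have [h] := twist_descent 0 tq.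
move=> /mcoeff_mul_neq0 [F1 [F2 [EF _ H]]].
exists (F2 + const_mnm (2 ^ q.+1 - t))%MM.
  move=> i; rewrite mnmDE mnmE.
  have := congr1 (fun m : 'X_{1..4} => m i) EF; rewrite mnmDE mnmE expnS.
  by move: tq; set Q := (2 ^ q)%N; lia.
rewrite exprMn mulrC.
have -> : (\prod_i 'X_i : poly4) ^+ (2 ^ q.+1 - t) = 'X_[const_mnm (2 ^ q.+1 - t)].
  by rewrite mpolyXE_id -prodrXl; apply: eq_bigr => i _; rewrite mnmE.
by rewrite addmC mcoeffMX.
Qed.
End TripleCoefficient.

(** Modulo 2, the coefficient of [prod_i 'X_i ^+ d] in the product over [c] of the linear forms
    [sum_(i in A c) 'X_i]. *)
Definition choice_count (k : nat) (C : finType) (A : C -> {set 'I_k}) (d : nat) : 'F_2 :=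
  \sum_(f : {ffun C -> 'I_k} | [forall c, f c \in A c] &&
     [forall i, #|[set c | f c == i]| == d]) 1.

(** * Constraints for the sets of hyperplanes *)

Section Constraints.
Variables (k l m : nat) (e : 'I_k -> nat).

(* One constraint for each mass and each set of at most [l] hyperplanes; the
   singletons on the right only serve to bring all degrees up to [d]. *)
Definition constraint : finType :=
  ({A : {set 'I_k} | (0 < #|A| <= l)%N} * 'I_m + {i : 'I_k & 'I_(e i)})%type.

Definition support (c : constraint) : {set 'I_k} :=
  match c with inl x => val x.1 | inr u => [set tag u] end.

End Constraints.

Section CountChoices.
Import mpoly.

(** The added singletons multiply by the monomial of exponent [d - E], which moves the coefficient
    at [E] to the constant exponent [d]. *)
Lemma choice_count_neq0 k l m d (E : 'X_{1..k}) : (forall i, E i <= d)%N ->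
  ((\prod_(A : {set 'I_k} | (0 < #|A| <= l)%N) \sum_(i in A) 'X_i :
    {mpoly 'F_2[k]}) ^+ m)@_E != 0 ->
  choice_count (@support k l m (fun i => d - E i)%N) d != 0.
Proof.
move=> Ed; set e := fun i => (d - E i)%N.
have -> : choice_count (@support k l m e) d =
    (\prod_(c : constraint l m e) \sum_(i in support c) 'X_i :
      {mpoly 'F_2[k]})@_[multinom d | _ < k].
  rewrite mcoeff_prod_linear; apply: eq_bigl => f; congr (_ && _).
  by apply: eq_forallb => i; rewrite mnmE.
have P1 : \prod_(x : {A : {set 'I_k} | (0 < #|A| <= l)%N} * 'I_m)
    \sum_(i in @support k l m e (inl x)) 'X_i =
    (\prod_(A : {set 'I_k} | (0 < #|A| <= l)%N) \sum_(i in A) 'X_i) ^+ m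
    :> {mpoly 'F_2[k]}.
  transitivity (\prod_(A : {A : {set 'I_k} | (0 < #|A| <= l)%N}) \prod_(j < m)
      \sum_(i in val A) 'X_i : {mpoly 'F_2[k]}); first by rewrite pair_bigA.
  under eq_bigr do rewrite prodr_const card_ord.
  rewrite prodrXl; congr (_ ^+ _).
  have := @big_sub_cond _ _ (GRing.mul : Monoid.com_law (1 : {mpoly 'F_2[k]})) _
    [pred A : {set 'I_k} | (0 < #|A| <= l)%N] xpredT (fun A => \sum_(i in A) 'X_i).
  by move=> <-; apply: eq_bigl => A; rewrite andbT.
have P2 : \prod_(u : {i : 'I_k & 'I_(e i)}) \sum_(i in @support k l m e (inr u)) 'X_i =
    \prod_i 'X_i ^+ e i :> {mpoly 'F_2[k]}.
  transitivity (\prod_i \prod_(j < e i) 'X_i : {mpoly 'F_2[k]}); last first.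
    by apply: eq_bigr => i _; rewrite prodr_const card_ord.
  rewrite (sig_big_dep xpredT (fun _ => xpredT) (fun i (_ : 'I_(e i)) => 'X_i)) /=.
  by apply: eq_bigr => u _; rewrite big_set1.
rewrite big_sumType P1 P2.
have -> : \prod_i 'X_i ^+ e i = 'X_[[multinom e i | i < k]] :> {mpoly 'F_2[k]}.
  by rewrite mpolyXE_id; apply: eq_bigr => i _; rewrite mnmE.
rewrite (_ : [multinom d | _ < k] = ([multinom e i | i < k] + E)%MM); last first.
  by apply/mnmP => i; rewrite mnmDE !mnmE /e subnK.
by rewrite mcoeffMX.
Qed.

Lemma prod_singletons (R : comPzRingType) k (F : {set 'I_k} -> R) :
  \prod_(A : {set 'I_k} | #|A| == 1%N) F A = \prod_i F [set i].
Proof.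
transitivity (\prod_(A in [set [set i] | i in 'I_k]) F A).
  apply: eq_bigl => A; apply/cards1P/imsetP => [[i ->]|[i _ ->]]; by exists i.
by rewrite big_imset //= => i j _ _; apply: set1_inj.
Qed.

Lemma prod_pairs (R : comPzRingType) k (F : {set 'I_k} -> R) :
  \prod_(A : {set 'I_k} | #|A| == 2%N) F A =
  \prod_(i < k) \prod_(j < k | (i < j)%N) F [set i; j].
Proof.
rewrite pair_big_dep /=.
pose D := [set x : 'I_k * 'I_k | (x.1 < x.2)%N].
transitivity (\prod_(A in [set [set x.1; x.2] | x in D]) F A).
  apply: eq_bigl => A; apply/cards2P/imsetP => [[i [j] [ij ->]]|[[i j]]].
    have [lt|gt|/val_inj E] := ltngtP i j; last by rewrite E eqxx in ij.
      by exists (i, j); rewrite ?inE.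
    by exists (j, i); rewrite ?inE //= setUC.
  by rewrite inE /= => ij ->; exists i, j; split=> //; rewrite neq_ltn ij.
rewrite big_imset /=; first by apply: eq_bigl => x; rewrite inE.
move=> [i j] [i' j']; rewrite !inE /= => ij ij' /setP E.
have := E i; have := E j; have := E i'; have := E j'.
rewrite !inE !eqxx /= !orbT -!val_eqE /= => h1 h2 h3 h4.
by congr (_, _); apply/val_inj; move: h1 h2 h3 h4 => /=; lia.
Qed.

Lemma prod_triples (R : comPzRingType) (F : {set 'I_4} -> R) :
  \prod_(A : {set 'I_4} | #|A| == 3%N) F A = \prod_(i < 4) F (~: [set i]).
Proof.
rewrite (reindex_inj (@setC_inj _)) /= -(prod_singletons (fun A => F (~: A))).
by apply: eq_bigl => A; have := cardsC A; rewrite card_ord; move: (#|A|) (#|~: A|) => a b; lia.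
Qed.

Lemma pair_constraints k q t : (0 < k)%N -> (1 <= t <= 2 ^ q)%N ->
  exists e : 'I_k -> nat,
    choice_count (@support k 2 (2 ^ q.+1 - t) e) (2 ^ q * (k + 1) - t) != 0.
Proof.
move=> k0 tq; have [E Ed H] := pair_coefficient k0 tq.
exists (fun i => 2 ^ q * (k + 1) - t - E i)%N; apply: (choice_count_neq0 Ed).
suff -> : \prod_(A : {set 'I_k} | (0 < #|A| <= 2)%N) \sum_(i in A) 'X_i =
  \prod_i 'X_i * vandermonde2 k by exact: H.
rewrite (bigID (fun A : {set 'I_k} => #|A| == 1%N)) /=; congr (_ * _).
  transitivity (\prod_(A : {set 'I_k} | #|A| == 1%N) \sum_(i in A) 'X_i :
      {mpoly 'F_2[k]}).
    by apply: eq_bigl => A; case: #|A| => [|[|[|[]]]].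
  by rewrite prod_singletons; apply: eq_bigr => i _; rewrite big_set1.
rewrite /vandermonde2.
transitivity (\prod_(A : {set 'I_k} | #|A| == 2%N) \sum_(i in A) 'X_i : {mpoly 'F_2[k]});
  last first.
  rewrite prod_pairs; apply: eq_bigr => i _; apply: eq_bigr => j ij.
  by rewrite big_setU1 ?big_set1 // inE neq_ltn ij.
by apply: eq_bigl => A; case: #|A| => [|[|[]]].
Qed.

Lemma triple_constraints q t : (1 <= t <= 2 ^ q)%N ->
  exists e : 'I_4 -> nat,
    choice_count (@support 4 3 (2 ^ q.+1 - t) e) (7 * 2 ^ q - 2 * t) != 0.
Proof.
move=> tq; have [E Ed H] := triple_coefficient tq.
exists (fun i => 7 * 2 ^ q - 2 * t - E i)%N; apply: (choice_count_neq0 Ed).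
suff -> : \prod_(A : {set 'I_4} | (0 < #|A| <= 3)%N) \sum_(i in A) 'X_i =
  \prod_i 'X_i * pair_triple_form by exact: H.
rewrite (bigID (fun A : {set 'I_4} => #|A| == 1%N)) /=; congr (_ * _).
  transitivity (\prod_(A : {set 'I_4} | #|A| == 1%N) \sum_(i in A) 'X_i :
      {mpoly 'F_2[4]}).
    by apply: eq_bigl => A; case: #|A| => [|[|[|[]]]].
  by rewrite prod_singletons; apply: eq_bigr => i _; rewrite big_set1.
rewrite (bigID (fun A : {set 'I_4} => #|A| == 2%N)) /= /pair_triple_form; congr (_ * _).
  transitivity (\prod_(A : {set 'I_4} | #|A| == 2%N) \sum_(i in A) 'X_i : {mpoly 'F_2[4]});
    last first.
    rewrite prod_pairs; apply: eq_bigr => i _; apply: eq_bigr => j ij.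
    by rewrite big_setU1 ?big_set1 // inE neq_ltn ij.
  by apply: eq_bigl => A; case: #|A| => [|[|[|[]]]].
transitivity (\prod_(A : {set 'I_4} | #|A| == 3%N) \sum_(i in A) 'X_i : {mpoly 'F_2[4]});
  last first.
  by rewrite prod_triples; apply: eq_bigr => i _; apply: eq_bigl => j; rewrite !inE.
by apply: eq_bigl => A; case: #|A| => [|[|[|[|[]]]]].
Qed.
End CountChoices.

(** * Common zeros *)

Section DiscreteZero.
Variables (k d : nat).
Hypotheses (k_gt0 : (0 < k)%N) (d_gt0 : (0 < d)%N).
Local Notation n := (k * d)%N.

(** The coordinates are the entries of a [k] by [d] matrix, flattened as by [mxvec]; the block is
    the row. *)
Definition block_of (r : 'I_n) : 'I_k :=
  (enum_val (cast_ord (esym (mxvec_cast k d)) r)).1.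

Lemma block_of_mxvec i j : block_of (mxvec_index i j) = i.
Proof. by rewrite /block_of /mxvec_index cast_ordK enum_rankK. Qed.

Lemma card_block i : #|[set r | block_of r == i]| = d.
Proof.
transitivity #|[set mxvec_index i j | j in 'I_d]|.
  apply: eq_card => r; rewrite inE; case/mxvec_indexP: r => i' j.
  rewrite block_of_mxvec; apply/eqP/imsetP => [->|[j' _ E]]; first by exists j.
  by have := congr1 block_of E; rewrite !block_of_mxvec.
rewrite card_imset ?card_ord // => j j' /cast_ord_inj/enum_rank_inj.
by case.
Qed.

Lemma is_balancedE (f : 'I_n -> 'I_k) :
  is_balanced block_of f = [forall i, #|[set a | f a == i]| == d].
Proof.
have cnt (g : 'I_n -> 'I_k) i : count_mem i [tuple g a | a < n] = #|[set a | g a == i]|.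
  rewrite -[tval _]/(map g (enum 'I_n)) count_map -sum1_count big_enum_cond.
  by rewrite -sum1_card; apply: eq_bigl => a; rewrite /= inE.
have -> : is_balanced block_of f =
    perm_eq [tuple f a | a < n] [tuple block_of a | a < n].
  apply/existsP/tuple_permP => -[rho H]; exists rho.
    congr val; apply/eq_from_tnth => a; rewrite !tnth_mktuple.
    by move/forallP: H => /(_ a)/eqP.
  apply/forallP => a; move/val_inj: H => /(congr1 (fun t => tnth t a)).
  by rewrite !tnth_mktuple => ->.
apply/idP/forallP => [/seq.permP P i|P]; first by rewrite -cnt P cnt card_block.
apply/allP => i _; apply/eqP; rewrite [LHS]cnt [RHS]cnt card_block.
by apply/eqP.
Qed.

(** A nonzero count provides a choice that takes each of the [k] indices [d] times. *)
Lemma card_constraints (C : finType) (A : C -> {set 'I_k}) :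
  choice_count A d != 0 ->
  #|C| = n.
Proof.
move=> H; case: (boolP [exists f : {ffun C -> 'I_k}, [forall c, f c \in A c] &&
     [forall i, #|[set c | f c == i]| == d]]) => [/existsP [f]|/existsPn N].
  case/andP => _ /forallP fd; rewrite -cardsT -sum1_card.
  rewrite (partition_big f xpredT) //= -[k in RHS]card_ord -sum_nat_const.
  apply: eq_bigr => i _; rewrite -(eqP (fd i)) -sum1_card.
  by apply: eq_bigl => c; rewrite !inE.
by case/eqP: H; apply: big_pred0 => f; apply/negbTE.
Qed.

(** With the constraints numbered by the coordinates, the sum in [flag_sum_count] is the nonzero
    [choice_count], so some flag has only nonzero factors. *)
Lemma discrete_zero (C : finType) (A : C -> {set 'I_k}) (m : nat)
    (s : C -> {ffun 'I_n -> nat} -> bool) :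
  choice_count A d != 0 ->
  (0 < m)%N ->
  (forall c, equivariant m.*2 block_of (A c) (fun v => (s c v)%:R)) ->
  exists F : flag n m.*2, forall c, exists j, s c (vert F j) != s c (vert F j.+1).
Proof.
move=> H m0 sA; have Cn := card_constraints H.
have n0 : (0 < n)%N by rewrite muln_gt0 k_gt0.
pose g (a : 'I_n) : C := enum_val (cast_ord (esym Cn) a).
pose g' (c : C) : 'I_n := cast_ord Cn (enum_rank c).
have gK : cancel g g' by move=> a; rewrite /g /g' enum_valK cast_ordKV.
have g'K : cancel g' g by move=> c; rewrite /g /g' cast_ordK enum_rankK.
have := @flag_sum_count n k m block_of n0 m0 (fun a => A (g a))
  (fun a v => (s (g a) v)%:R) (fun a => sA (g a)).
set S := (X in _ = X) => E.
have SE : S = choice_count A d.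
  rewrite /S /choice_count (reindex (fun f : {ffun C -> 'I_k} => [ffun a => f (g a)])) /=; last first.
    exists (fun f : {ffun 'I_n -> 'I_k} => [ffun c => f (g' c)]) => f _;
      by apply/ffunP => x; rewrite !ffunE ?g'K ?gK.
  apply: eq_bigl => f; congr (_ && _).
    apply/forallP/forallP => h c; last by rewrite ffunE; apply: h.
    by have := h (g' c); rewrite ffunE g'K.
  rewrite is_balancedE; apply: eq_forallb => i; congr (_ == _).
  rewrite -(card_imset _ (can_inj gK)); apply: eq_card => c; rewrite inE.
  apply/imsetP/idP => [[a + ->]|h]; first by rewrite inE ffunE.
  by exists (g' c); rewrite ?inE ?ffunE ?g'K.
have {H}H : \sum_(F : flag n m.*2) \prod_a ((s (g a) (vert F a))%:R +
    (s (g a) (vert F a.+1))%:R) != 0 :> 'F_2 by rewrite E SE.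
case: (boolP [exists F : flag n m.*2,
    [forall a : 'I_n, s (g a) (vert F a) != s (g a) (vert F a.+1)]]).
  case/existsP => F /forallP FH; exists F => c; exists (g' c).
  by have := FH (g' c); rewrite g'K.
move=> /existsPn N; case/eqP: H; apply: big1 => F _; apply/eqP.
apply: contraNT (N F) => /prodf_neq0 P; apply/forallP => a.
by have := P a isT; rewrite F2_bool_addN.
Qed.
End DiscreteZero.

From mathcomp Require Import all_classical all_reals all_analysis.
Import numFieldNormedType.Exports.
Local Open Scope classical_set_scope.
From mathcomp Require Import measurable_realfun.

Section Subsequences.
Variable R : realType.

Lemma increasing_seq_ge (f : nat -> nat) n : increasing_seq f -> (n <= f n)%N.
Proof.
move=> /increasing_seqP fi; elim: n => // n IH.
exact: leq_ltn_trans IH (fi n).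
Qed.

Lemma increasing_seq_cvg (f : nat -> nat) : increasing_seq f -> f @ \oo --> \oo.
Proof.
move=> fi; apply/cvgnyPge => A; near=> n.
by apply: leq_trans (increasing_seq_ge n fi); near: n; apply: nbhs_infty_ge.
Unshelve. all: by end_near. Qed.

Lemma bolzano_weierstrass_finite (I : finType) (x : nat -> I -> R) :
  (forall n i, `|x n i| <= 1) ->
  exists f : nat -> nat, increasing_seq f /\
    exists l : I -> R, forall i, (fun n => x (f n) i) @ \oo --> l i.
Proof.
move=> x1.
suff [f [fi fc]] : exists f : nat -> nat, increasing_seq f /\
    forall i, i \in enum I -> cvgn (fun n => x (f n) i).
  exists f; split=> //; exists (fun i => lim ((fun n => x (f n) i) @ \oo)) => i.
  by apply: fc; rewrite mem_enum.
elim: (enum I) => [|i s [f [fi fc]]].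
  by exists id; split=> // m n.
have [|g gi gc] := @bolzano_weierstrass R (fun n => x (f n) i).
  exists 1; split; first exact: num_real.
  by move=> M M1 n _ /=; apply: le_trans (ltW M1); apply: x1.
exists (f \o g); split; first by move=> m n /=; rewrite -[LHS]/(f (g m) <= f (g n))%O fi; apply: gi.
move=> j; rewrite inE => /orP[/eqP ->|/fc/cvg_ex[l fl]]; first exact: gc.
apply/cvg_ex; exists l.
exact: (cvg_comp _ _ (increasing_seq_cvg gi) fl).
Qed.
End Subsequences.

(** * From flags on fine grids to a common zero *)

Section CommonZero.
Variables (R : realType) (k d : nat).
Hypotheses (k_gt0 : (0 < k)%N) (d_gt0 : (0 < d)%N).
Implicit Types P : 'M[R]_(k, d).

Definition in_cube P := forall i j, `|P i j| <= 1.

Definition negate_row (i : 'I_k) P : 'M[R]_(k, d) :=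
  \matrix_(i', j) if i' == i then - P i' j else P i' j.

(** On a grid with [m.*2] cells per side the doubled coordinates run up to [m.*2.*2]; they are
    rescaled to the interval from -1 to 1. *)
Definition grid_point (m : nat) (v : {ffun 'I_(k * d) -> nat}) : 'M[R]_(k, d) :=
  \matrix_(i, j) ((v (mxvec_index i j))%:R / m.*2%:R - 1).

Lemma grid_point_in_cube m (v : {ffun 'I_(k * d) -> nat}) : (0 < m)%N -> (forall r, v r <= m.*2.*2)%N ->
  in_cube (grid_point m v).
Proof.
move=> m0 vm i j; rewrite mxE ler_norml lerBrDr lerBlDr addNr -[1 + 1]/(2%:R).
have M0 : (0 : R) < m.*2%:R by rewrite ltr0n double_gt0.
rewrite divr_ge0 ?ler0n //= ler_pdivrMr // -natrM ler_nat mul2n; exact: vm.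
Qed.

Lemma grid_point_antipode m i (v : {ffun 'I_(k * d) -> nat}) : (0 < m)%N -> (forall r, v r <= m.*2.*2)%N ->
  grid_point m (antipode m.*2 (@block_of k d) i v) = negate_row i (grid_point m v).
Proof.
move=> m0 vm; apply/matrixP => i' j; rewrite !mxE !ffunE block_of_mxvec.
case: eqP => // _; rewrite natrB // mulrBl -[m.*2.*2]muln2 natrM.
have M0 : m.*2%:R != 0 :> R by rewrite pnatr_eq0 double_eq0 -lt0n.
by rewrite mulrAC mulfV // mul1r opprB; ring.
Qed.

Lemma grid_point_boundary m i v : (0 < m)%N ->
  on_boundary m.*2 (@block_of k d) i v -> exists j, `|grid_point m v i j| = 1.
Proof.
move=> m0 [_ [r [ri rv]]]; case/mxvec_indexP: r ri rv => i' j.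
rewrite block_of_mxvec => -> rv; exists j; rewrite mxE.
have M0 : m.*2%:R != 0 :> R by rewrite pnatr_eq0 double_eq0 -lt0n.
case: rv => ->; first by rewrite mul0r add0r normrN normr1.
by rewrite -[m.*2.*2]muln2 natrM mulrAC mulfV // mul1r addrK normr1.
Qed.

Lemma grid_point_vert m (F : flag (k * d) m.*2) a b i j : (0 < m)%N ->
  `|grid_point m (vert F a) i j - grid_point m (vert F b) i j| <= m%:R^-1.
Proof.
move=> m0; have le1 a' b' r : ((vert F a' r)%:R : R) <= (vert F b' r)%:R + 1.
  rewrite natr1 ler_nat; case: F => [[y e] p]; rewrite !ffunE.
  by case: (e r) => /=; do 2 case: ifP => _; lia.
rewrite !mxE opprD addrACA subrr addr0 -mulrBl normrM normfV [`|m.*2%:R|]ger0_norm //.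
apply: (@le_trans _ _ (1 / m.*2%:R)).
  rewrite ler_wpM2r ?invr_ge0 // ler_norml lerBlDr lerBrDr addrC.
  by rewrite [1 + _]addrC !le1 lerBlDr le1.
rewrite div1r lef_pV2 ?posrE ?ltr0n ?double_gt0 // ler_nat; lia.
Qed.

Lemma mulr_le0_sign (a b : R) : (0 < a) != (0 < b) -> a * b <= 0.
Proof.
case: (ltP 0 a) => a0; case: (ltP 0 b) => b0 // _.
  by rewrite pmulr_rle0.
by rewrite pmulr_lle0.
Qed.

Theorem common_zero (C : finType) (A : C -> {set 'I_k}) (G : C -> 'M[R]_(k, d) -> R) :
  choice_count A d != 0 ->
  (forall c i P, in_cube P -> (exists j, `|P i j| = 1) ->
     G c (negate_row i P) = (-1) ^+ (i \in A c) * G c P) ->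
  (forall c (u : nat -> 'M[R]_(k, d)) P, (forall n, in_cube (u n)) ->
     (forall i j, (fun n => u n i j) @ \oo --> P i j) ->
     (fun n => G c (u n)) @ \oo --> G c P) ->
  exists P, in_cube P /\ forall c, G c P = 0.
Proof.
move=> cnt Godd Gcont.
have n0 : (0 < k * d)%N by rewrite muln_gt0 k_gt0.
have close m : (0 < m)%N -> exists x : 'M[R]_(k, d), in_cube x /\
    forall c, exists y z : 'M[R]_(k, d), [/\ in_cube y, in_cube z,
      G c y * G c z <= 0,
      forall i j, `|y i j - x i j| <= m%:R^-1 &
      forall i j, `|z i j - x i j| <= m%:R^-1].
  move=> m0; pose G' c v := G c (grid_point m v).
  (* Where [G c] vanishes it has no sign, and [def c] supplies a value with the required
     symmetry. *)
  pose def c v := \sum_(i in A c) block_sign m (@block_of k d) n0 i v.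
  pose s c v := if G' c v == 0 then def c v != 0 else 0 < G' c v.
  have defE c v : (def c v != 0)%:R = def c v.
    by have [->//|/F2_neq0 ->] := eqVneq (def c v) 0.
  have sA c : equivariant m.*2 (@block_of k d) (A c) (fun v => (s c v)%:R).
    move=> i v vb; have [vm _] := vb.
    have E : G' c (antipode m.*2 (@block_of k d) i v) = (-1) ^+ (i \in A c) * G' c v.
      rewrite /G' grid_point_antipode //; apply: Godd; first exact: grid_point_in_cube.
      exact: grid_point_boundary vb.
    rewrite /s E mulf_eq0 signr_eq0 /=; case: eqP => [_|/eqP G0].
      by rewrite !defE; apply: block_sign_equivariant.
    case: (i \in A c) => /=; last by rewrite expr0 mul1r addr0.
    rewrite expr1 mulN1r oppr_gt0; case: ltgtP G0 => //= _ _;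
      by apply/val_inj.
  have [F HF] := discrete_zero k_gt0 d_gt0 cnt m0 sA.
  have cube a : in_cube (grid_point m (vert F a)).
      by apply: grid_point_in_cube => // r; apply: vert_le; rewrite ?double_gt0.
  exists (grid_point m (vert F 0)); split=> // c.
  have [a Ha] := HF c; exists (grid_point m (vert F a)), (grid_point m (vert F a.+1)).
  split=> //; try by move=> i j; apply: grid_point_vert.
  move: Ha; rewrite /s -!/(G' _ _).
  have [->|y0] := eqVneq (G' c (vert F a)) 0; first by rewrite mul0r.
  have [->|z0] := eqVneq (G' c (vert F a.+1)) 0; first by rewrite mulr0.
  exact: mulr_le0_sign.
have {close} /choice [x Hx] (m : nat) := close m.+1 isT.
have /choice [yz Hyz] (mc : nat * C) : exists yz : 'M[R]_(k, d) * 'M[R]_(k, d),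
    [/\ in_cube yz.1, in_cube yz.2, G mc.2 yz.1 * G mc.2 yz.2 <= 0,
      forall i j, `|yz.1 i j - x mc.1 i j| <= mc.1.+1%:R^-1 &
      forall i j, `|yz.2 i j - x mc.1 i j| <= mc.1.+1%:R^-1].
  by have [_ /(_ mc.2) [y [z H]]] := Hx mc.1; exists (y, z).
have [f [fi [l xl]]] := @bolzano_weierstrass_finite R ('I_k * 'I_d)%type
  (fun n ij => x n ij.1 ij.2) (fun n ij => (Hx n).1 ij.1 ij.2).
pose P : 'M[R]_(k, d) := \matrix_(i, j) l (i, j).
have xP i j : (fun n => x (f n) i j) @ \oo --> P i j.
  by rewrite mxE; apply: (xl (i, j)).
have near_cvg (u : nat -> 'M[R]_(k, d)) :
    (forall n i j, `|u n i j - x (f n) i j| <= (f n).+1%:R^-1) ->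
    forall i j, (fun n => u n i j) @ \oo --> P i j.
  move=> uP i j.
  have -> : (fun n => u n i j) = (fun n => (u n i j - x (f n) i j) + x (f n) i j).
    by apply/funext => n; rewrite subrK.
  rewrite -[P i j]add0r; apply: cvgD; last exact: xP.
  apply/norm_cvg0P; apply: (@squeeze_cvgr _ _ _ _ (fun=> 0) (fun n => n.+1%:R^-1)).
  - near=> n; rewrite normr_ge0 /=; apply: le_trans (uP _ _ _) _.
    by rewrite lef_pV2 ?posrE ?ltr0n // ler_nat ltnS; apply: increasing_seq_ge.
  - exact: cvg_cst.
  - exact: cvg_harmonic.
have cubeP : in_cube P.
  move=> i j; have /cvg_lim <- // : (fun n => `|x (f n) i j|) @ \oo --> `|P i j|.
    exact: cvg_norm.
  apply: limr_le; first by apply/cvg_ex; exists `|P i j|; apply: cvg_norm.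
  by near=> n; apply: (Hx (f n)).1.
exists P; split=> // c.
have Gy : (fun n => G c (yz (f n, c)).1) @ \oo --> G c P.
  apply: Gcont => [n|]; first by have [] := Hyz (f n, c).
  by apply: near_cvg => n; have [] := Hyz (f n, c).
have Gz : (fun n => G c (yz (f n, c)).2) @ \oo --> G c P.
  apply: Gcont => [n|]; first by have [] := Hyz (f n, c).
  by apply: near_cvg => n; have [] := Hyz (f n, c).
have Gyz : (fun n => G c (yz (f n, c)).1 * G c (yz (f n, c)).2) @ \oo -->
    G c P * G c P by exact: cvgM.
(* The nonpositive products converge to a square, which must be zero. *)
have h : G c P * G c P <= 0.
  have /cvg_lim <- // := Gyz.
  apply: limr_le; first by apply/cvg_ex; eexists; exact: Gyz.
  by near=> n; have [] := Hyz (f n, c).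
by apply/eqP; rewrite -sqrf_eq0 eq_le expr2 h -expr2 sqr_ge0.
Unshelve. all: by end_near. Qed.
End CommonZero.

(** * Masses and hyperplanes *)

Section HyperplaneNull.
Variable R : realType.

Lemma grid_cell (N : R) g (x : R) : (0 < g)%N -> 0 < N -> - N <= x <= N ->
  exists m : 'I_g, - N + 2 * N / g%:R * m%:R <= x <= - N + 2 * N / g%:R * m.+1%:R.
Proof.
move=> g0 N0 /andP[x1 x2].
set D := 2 * N / g%:R; have g0' : (0 : R) < g%:R by rewrite ltr0n.
have D0 : 0 < D by rewrite divr_gt0 ?mulr_gt0.
have DE (z : R) m1 m2 : m1 <= z / D <= m2 -> D * m1 <= z <= D * m2.
  by rewrite ler_pdivlMr // ler_pdivrMr // ![_ * D]mulrC.
have y0 : 0 <= (x + N) / D by rewrite divr_ge0 ?(ltW D0) // -lerBlDr sub0r.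
have /andP[t1 t2] := truncn_itv y0.
have [tg|tg] := ltnP (Num.truncn ((x + N) / D)) g.
  exists (Ordinal tg) => /=.
  have /DE : (Num.truncn ((x + N) / D))%:R <= (x + N) / D <=
    (Num.truncn ((x + N) / D)).+1%:R by rewrite t1 ltW.
  by move: (D * _) (D * _) => r1 r2; lra.
(* Only [x = N] is left, and it lies in the last cell. *)
have gp : (g.-1 < g)%N by rewrite prednK.
exists (Ordinal gp) => /=; rewrite prednK //.
have DN : D * g%:R = 2 * N by rewrite /D divfK ?gt_eqF.
have /DE/andP[] : g.-1%:R <= (x + N) / D <= g%:R.
  apply/andP; split; first by apply: le_trans t1; rewrite ler_nat (leq_trans _ tg) ?leq_pred.
  by rewrite ler_pdivrMr // mulrC DN; lra.
by rewrite DN; move: (D * _) => r1; lra.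
Qed.

(* A bounded piece of a hyperplane is a Lipschitz graph over the coordinates
   other than [i0]: cover it by the boxes over a fine grid. *)
Lemma bounded_hyperplane_null (d : nat) (a : 'rV[R]_d) (b N : R) :
  a != 0 -> 0 < N ->
  lebesgue_null [set u : 'rV[R]_d | dotv u a = b /\ forall i, `|u 0 i| <= N].
Proof.
case: d a => [a|d a a0 N0 eps eps0]; first by rewrite thinmx0 eqxx.
have [i0 ai0] : exists i0, a 0 i0 != 0.
  apply/existsP; apply: contraNT a0 => /existsPn H; apply/eqP/rowP => i.
  by rewrite mxE; apply/eqP; have := H i; rewrite negbK.
(* A Lipschitz constant of the graph for the maximum norm. *)
pose L := (\sum_(j < d) `|a 0 (lift i0 j)|) / `|a 0 i0|.
have L0 : 0 <= L by rewrite divr_ge0 // sumr_ge0.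
(* The quantity kept below [eps] is the total volume of [g ^ d] boxes of width [2 * N / g] and
   height [2 * L * (2 * N / g)]. *)
have [g g0 gE] : exists2 g : nat, (0 < g)%N &
    (2 * N) ^+ d * (2 * L * (2 * N)) / g%:R < eps.
  pose K := (2 * N) ^+ d * (2 * L * (2 * N)).
  exists (Num.truncn (K / eps)).+1 => //.
  rewrite -/K ltr_pdivrMr ?ltr0n // [eps * _]mulrC -ltr_pdivrMr //.
  exact: truncnS_gt.
have g0' : (0 : R) < g%:R by rewrite ltr0n.
pose D := 2 * N / g%:R; have D0 : 0 < D by rewrite divr_gt0 ?mulr_gt0.
pose T := {ffun 'I_d -> 'I_g}.
pose lo (f : T) j := - N + D * (f j : nat)%:R.
pose h (f : T) := (b - \sum_(j < d) lo f j * a 0 (lift i0 j)) / a 0 i0.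
pose bl (f : T) : 'rV[R]_d.+1 :=
  \row_j if unlift i0 j is Some j' then lo f j' else h f - L * D.
pose bh (f : T) : 'rV[R]_d.+1 :=
  \row_j if unlift i0 j is Some j' then lo f j' + D else h f + L * D.
have blh f j : bl f 0 j <= bh f 0 j.
  rewrite !mxE; case: unliftP => [j'|] _; first by rewrite lerDl ltW.
  by have : 0 <= L * D; [rewrite mulr_ge0 // ltW|lra].
have vol f : \prod_(j < d.+1) (bh f 0 j - bl f 0 j) = D ^+ d * (2 * L * D).
  rewrite (bigD1 i0) //= !mxE unlift_none mulrC; congr (_ * _); last by ring.
  rewrite (eq_bigr (fun _ => D)) => [|j ji].
    by rewrite prodr_const cardC1 card_ord.
  by rewrite !mxE; case: unliftP ji => [j' _ _|->]; [ring|rewrite eqxx].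
(* After the last box the sequence continues with the degenerate box at 0, of volume zero in the
   positive dimension [d.+1]. *)
pose lo' n := if insub n is Some x then bl (enum_val (x : 'I_#|T|)) else 0.
pose hi' n := if insub n is Some x then bh (enum_val (x : 'I_#|T|)) else 0.
exists lo', hi'; split; [|split].
- by move=> n j; rewrite /lo' /hi'; case: insubP.
- move=> u [ub uN].
  have /choice [f Hf] (j : 'I_d) := grid_cell g0 N0
    (etrans (esym (ler_norml _ _)) (uN (lift i0 j))).
  exists (enum_rank [ffun j => f j]) => //.
  rewrite /lo' /hi' valK enum_rankK => j; rewrite !mxE.
  case: unliftP => [j'|] ->.
    rewrite /lo ffunE; have := Hf j'; rewrite -/D -natr1 mulrDr mulr1 addrA.
    exact.
  have ui0 : u 0 i0 = (b - \sum_(j < d) u 0 (lift i0 j) * a 0 (lift i0 j)) / a 0 i0.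
    apply: (mulIf ai0); rewrite divfK // -ub /dotv (bigD1_ord i0) //=.
    by rewrite addrK.
  have : `|u 0 i0 - h [ffun j => f j]| <= L * D.
    rewrite ui0 /h -mulrBl.
    rewrite (_ : _ - _ = \sum_(j < d) lo [ffun j => f j] j * a 0 (lift i0 j) -
      \sum_(j < d) u 0 (lift i0 j) * a 0 (lift i0 j)); last by ring.
    rewrite -sumrB.
    rewrite normrM normfV /L mulrAC ler_wpM2r ?invr_ge0 // mulr_suml.
    apply: le_trans (ler_norm_sum _ _ _) _; apply: ler_sum => l _.
    rewrite -mulrBl normrM mulrC ler_wpM2l //.
    have := Hf l; rewrite -/D /lo ffunE -natr1 mulrDr mulr1 => /andP[h1 h2].
    by rewrite ler_norml; lra.
  by rewrite ler_norml; lra.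
- rewrite (@nneseries_split _ _ 0%N #|T|); last first.
    move=> n _; rewrite lee_fin prodr_ge0 // => j _; rewrite subr_ge0.
    by rewrite /lo' /hi'; case: insubP.
  rewrite add0n [X in (_ + X)%E]eseries0 ?adde0; last first.
    move=> n; rewrite leqNgt => nT _; rewrite /lo' /hi' insubN //.
    by rewrite big_ord_recl !mxE subrr mul0r.
  rewrite big_mkord (eq_bigr (fun _ => (D ^+ d * (2 * L * D))%:E)); last first.
    by move=> n _; rewrite /lo' /hi' valK vol.
  rewrite sumEFin lte_fin sumr_const card_ord card_ffun !card_ord.
  apply: le_lt_trans gE; rewrite -[_ *+ (g ^ d)]mulr_natl natrX mulrA -exprMn.
  have -> : g%:R * D = 2 * N by rewrite /D mulrC divfK // gt_eqF.
  by rewrite /D !mulrA.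
Qed.
End HyperplaneNull.

(** * Sides of hyperplanes and their correlations *)

Section Masses.
Variables (R : realType) (d : nat).
Implicit Types (u a : 'rV[R]_d) (b : R).

Lemma cvg_sum_seq (I : Type) (s : seq I) (f : I -> nat -> R) (l : I -> R) :
  (forall i, f i @ \oo --> l i) ->
  (fun n => \sum_(i <- s) f i n) @ \oo --> \sum_(i <- s) l i.
Proof. by move=> fl; apply: cvg_big => //; apply: add_continuous. Qed.

Lemma cvg_prod_seq (I : Type) (s : seq I) (P : pred I) (f : I -> nat -> R) (l : I -> R) :
  (forall i, P i -> f i @ \oo --> l i) ->
  (fun n => \prod_(i <- s | P i) f i n) @ \oo --> \prod_(i <- s | P i) l i.
Proof. by move=> fl; apply: cvg_big => //; apply: mul_continuous. Qed.

Lemma dotv_continuous a : continuous (fun u => dotv u a).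
Proof.
rewrite /dotv; elim: (index_enum _) => [|i s IH] u.
  under eq_fun do rewrite big_nil; exact: cst_continuous.
under eq_fun do rewrite big_cons.
apply: (@continuousD _ _ _ (fun u : 'rV[R]_d => u 0 i * a 0 i)); last exact: IH.
apply: (@continuousM _ _ (fun u : 'rV[R]_d => u 0 i) (fun=> a 0 i)).
  exact: coord_continuous.
exact: cst_continuous.
Qed.

Lemma closed_measurable (A : set 'rV[R]_d) : closed A ->
  measurable (A : set (Rd R d)).
Proof.
move=> cA; rewrite -[A]setCK; apply: measurableC.
by apply: sub_sigma_algebra; rewrite openC.
Qed.

Lemma closed_dotv_ge a b : closed [set u : 'rV[R]_d | b <= dotv u a].
Proof.
apply: (@preimage_closed _ _ (fun u => dotv u a) [set x | b <= x]).
  by move=> u _; apply: dotv_continuous.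
exact: closed_ge.
Qed.

Lemma closed_dotv_le a b : closed [set u : 'rV[R]_d | dotv u a <= b].
Proof.
apply: (@preimage_closed _ _ (fun u => dotv u a) [set x | x <= b]).
  by move=> u _; apply: dotv_continuous.
exact: closed_le.
Qed.

Lemma closed_dotv_eq a b : closed [set u : 'rV[R]_d | dotv u a = b].
Proof.
rewrite (_ : mkset _ = [set u | b <= dotv u a] `&` [set u | dotv u a <= b]).
  by apply: closedI; [exact: closed_dotv_ge|exact: closed_dotv_le].
apply/seteqP; split => u /=; first by move=> ->.
by case=> h1 h2; apply/eqP; rewrite eq_le h1 h2.
Qed.

Lemma closed_cube N : closed [set u : 'rV[R]_d | forall i, `|u 0 i| <= N].
Proof.
rewrite (_ : mkset _ = \bigcap_(i in setT) [set u : 'rV[R]_d | `|u 0 i| <= N]).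
  apply: closed_bigI => i _.
  apply: (@preimage_closed _ _ (fun u : 'rV[R]_d => `|u 0 i|) [set x | x <= N]).
    move=> u _; apply: (@continuous_comp _ _ _ (fun u : 'rV[R]_d => u 0 i)
      (fun x : R => `|x|)); [exact: coord_continuous|exact: norm_continuous].
  exact: closed_le.
by apply/seteqP; split => u /= h i; [move=> _|]; apply: h.
Qed.

(** A hyperplane is a countable union of bounded pieces, null by [bounded_hyperplane_null]. *)
Lemma hyperplane_mass0 (mu : {finite_measure set (Rd R d) -> \bar R}) a b :
  abs_continuous mu -> a != 0 -> mu [set u | dotv u a = b] = 0%E.
Proof.
move=> mu_ac a0.
pose K (n : nat) : set (Rd R d) :=
  [set u | dotv u a = b /\ forall i, `|u 0 i| <= n.+1%:R].
have mK n : measurable (K n).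
  rewrite (_ : K n = [set u | dotv u a = b] `&` [set u | forall i, `|u 0 i| <= n.+1%:R]).
    by apply: closed_measurable; apply: closedI; [exact: closed_dotv_eq|exact: closed_cube].
  by [].
have K0 n : mu (K n) = 0%E.
  by apply: mu_ac; [exact: mK|apply: bounded_hyperplane_null].
apply: measure_negligible; first by apply: closed_measurable; exact: closed_dotv_eq.
rewrite (_ : mkset _ = \bigcup_n K n).
  apply: negligible_bigcup => n; exists (K n).
  by split; [exact: mK|exact: K0|].
apply/seteqP; split => u /=; last by case=> n _ [].
move=> ub; exists (Num.truncn (\sum_i `|u 0 i|)) => //; split=> // i.
apply: le_trans (ltW (truncnS_gt _)).
by rewrite (bigD1 i) //= lerDl sumr_ge0.
Qed.

(* +1, -1 and 0 on the two open sides of the hyperplane and on the hyperplane. *)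
Definition side (H : 'rV[R]_d * R) (u : Rd R d) : R := Num.sg (dotv u H.1 - H.2).

Lemma side_measurable H : measurable_fun setT (side H).
Proof.
have -> : side H = (fun u => \1_[set u | H.2 <= dotv u H.1] u -
    \1_[set u | dotv u H.1 <= H.2] u).
  apply/funext => u; rewrite /side !indicE.
  have M (Q : 'rV[R]_d -> bool) : (u \in [set x | Q x]) = Q u.
    by apply/idP/idP => [/set_mem|h] //; apply/mem_set.
  rewrite !M -subr_ge0 -[_ <= H.2]subr_le0; move: (dotv u H.1 - H.2) => x.
  case: (ltrgt0P x) => [h|h|->] /=; last by rewrite sgr0 subrr.
    by rewrite gtr0_sg // subr0.
  by rewrite ltr0_sg // sub0r.
apply: measurable_funB; apply: measurable_indic; apply: closed_measurable;
  [exact: closed_dotv_ge|exact: closed_dotv_le].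
Qed.

Lemma side_le1 H u : `|side H u| <= 1.
Proof. by rewrite /side normr_sg; case: eqP. Qed.

Section Correlation.
Variables (k : nat) (mu : {finite_measure set (Rd R d) -> \bar R}).
Implicit Types (H : 'I_k -> 'rV[R]_d * R) (A : {set 'I_k}).

Definition sides H A (u : Rd R d) : R := \prod_(i in A) side (H i) u.

Lemma sides_measurable H A : measurable_fun setT (sides H A).
Proof.
rewrite /sides; under eq_fun do rewrite -big_filter.
by apply: measurable_prod => i _; apply: side_measurable.
Qed.

Lemma sides_le1 H A u : `|sides H A u| <= 1.
Proof.
rewrite /sides normr_prod; apply: prodr_ile1 => i _.
by rewrite normr_ge0 side_le1.
Qed.

Lemma sides_integrable H A : mu.-integrable setT (EFin \o sides H A).
Proof.
apply: measurable_bounded_integrable => //.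
- by rewrite -ge0_fin_numE ?fin_num_measure.
- exact: sides_measurable.
- exists 1; split; first exact: num_real.
  by move=> x x1 u _ /=; apply: le_trans (ltW x1); apply: sides_le1.
Qed.

(** The Fourier coefficient of the mass at [A]. *)
Definition correlation H A : R := fine (\int[mu]_u (sides H A u)%:E).

Lemma correlationE H A : (\int[mu]_u (sides H A u)%:E = (correlation H A)%:E)%E.
Proof.
rewrite /correlation fineK //; apply: integrable_fin_num => //.
exact: sides_integrable.
Qed.

Lemma side_cvg (H_ : nat -> 'rV[R]_d * R) (H : 'rV[R]_d * R) u :
  (forall j, (fun n => (H_ n).1 0 j) @ \oo --> H.1 0 j) ->
  (fun n => (H_ n).2) @ \oo --> H.2 ->
  dotv u H.1 != H.2 -> (fun n => side (H_ n) u) @ \oo --> side H u.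
Proof.
move=> H1 H2 uH.
have cv : (fun n => dotv u (H_ n).1 - (H_ n).2) @ \oo --> dotv u H.1 - H.2.
  apply: cvgB => //; rewrite /dotv; apply: cvg_sum_seq => j.
  by apply: cvgMr.
apply: cvg_near_cst; rewrite /side.
have : dotv u H.1 - H.2 != 0 by rewrite subr_eq0.
move: (dotv u H.1 - H.2) cv => x cv x0.
case: (ltrgt0P x) x0 => // x0 _.
  apply: filterS (cvgr_gt _ cv _ x0) => n /= h.
  by rewrite !gtr0_sg.
apply: filterS (cvgr_lt _ cv _ x0) => n /= h.
by rewrite !ltr0_sg.
Qed.

(** Dominated convergence: the integrands converge off the limit hyperplanes, which have mass zero.
    A zero normal with nonzero offset gives the empty set and does no harm. *)
Lemma correlation_cvg (H_ : nat -> 'I_k -> 'rV[R]_d * R) H A :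
  abs_continuous mu ->
  (forall i j, (fun n => (H_ n i).1 0 j) @ \oo --> (H i).1 0 j) ->
  (forall i, (fun n => (H_ n i).2) @ \oo --> (H i).2) ->
  (forall i, (H i).1 = 0 -> (H i).2 != 0) ->
  (fun n => correlation (H_ n) A) @ \oo --> correlation H A.
Proof.
move=> mu_ac H1 H2 H0; apply: fine_cvg; rewrite -correlationE.
have := @dominated_convergence _ _ R mu setT measurableT
  (fun n u => (sides (H_ n) A u)%:E) (fun u => (sides H A u)%:E) (cst 1%:E).
case=> //.
- by move=> n; apply/measurable_EFinP; apply: sides_measurable.
- by apply/measurable_EFinP; apply: sides_measurable.
- have N i : mu.-negligible [set u : Rd R d | dotv u (H i).1 = (H i).2].
    have [E|E] := eqVneq (H i).1 0.
      rewrite (_ : mkset _ = set0); first exact: negligible_set0.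
      apply/seteqP; split=> // u /=; rewrite E /dotv big1 => [h|j _].
        by have := H0 i E; rewrite -h eqxx.
      by rewrite mxE mulr0.
    exists [set u : Rd R d | dotv u (H i).1 = (H i).2]; split=> //.
      by apply: closed_measurable; exact: closed_dotv_eq.
    exact: hyperplane_mass0.
  have aeN : \forall u \ae mu, forall i, dotv u (H i).1 != (H i).2.
    apply: filter_forall => i; apply: negligibleS (N i) => u /= /negP.
    by rewrite negbK => /eqP.
  apply: (@filterS _ _ (ae_filter_ringOfSetsType mu) _ _ _ aeN) => u uH _.
  have cv : (fun n => sides (H_ n) A u) @ \oo --> sides H A u.
    by apply: cvg_prod_seq => i _; apply: side_cvg.
  by apply: cvg_EFin cv; exact: nearW.
- exact: finite_measure_integrable_cst.
- by apply: aeW => u n _ /=; rewrite lee_fin sides_le1.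
Qed.

Lemma region_measurable H (S : {set 'I_k}) (eps : 'I_k -> bool) :
  measurable ([set u | forall i, i \in S -> halfspace (H i) (eps i) u] : set (Rd R d)).
Proof.
apply: closed_measurable; set Rg := mkset _.
rewrite (_ : Rg = \bigcap_(i in [set i | i \in S]) halfspace (H i) (eps i)) //.
apply: closed_bigI => i _; rewrite /halfspace; case: (eps i).
  exact: closed_dotv_ge.
exact: closed_dotv_le.
Qed.

Lemma correlation_scale H H' A (c : R) :
  (forall u, sides H' A u = c * sides H A u) ->
  correlation H' A = c * correlation H A.
Proof.
move=> E; apply: EFin_inj; rewrite EFinM -!correlationE.
rewrite -integralZl //; last exact: sides_integrable.
by apply: eq_integral => u _; rewrite E EFinM.
Qed.

(* Fourier expansion of the indicator of a region in the functions [sides]. *)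
Lemma region_measure H (S : {set 'I_k}) (eps : 'I_k -> bool) :
  abs_continuous mu -> (forall i, (H i).1 != 0) ->
  (forall A : {set 'I_k}, A != finset.set0 -> A \subset S -> correlation H A = 0) ->
  mu [set u | forall i, i \in S -> halfspace (H i) (eps i) u] =
    (mu setT * ((2%:R ^- #|S|)%:E))%E.
Proof.
move=> mu_ac H0 cor0; set Rg := mkset _.
have mRg : measurable (Rg : set (Rd R d)) by exact: region_measurable.
pose sg i : R := if eps i then 1 else -1.
(* With [F] zero off [S] the product runs over all indices, and subsets [J] not inside [S] get the
   coefficient [c J = 0]. *)
pose F i u : R := if i \in S then sg i * side (H i) u else 0.
pose c (J : {set 'I_k}) : R := if J \subset S then \prod_(i in J) sg i else 0.
have FE (J : {set 'I_k}) u : \prod_i (if i \in J then F i u else 1) = c J * sides H J u.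
  rewrite -big_mkcond /c /sides; case: ifP => [/fintype.subsetP JS|/negbT /subsetPn [i iJ iS]].
    by rewrite -big_split; apply: eq_bigr => i /JS iS; rewrite /F iS.
  by rewrite mul0r (bigD1 i) //= /F (negbTE iS) mul0r.
have E u : (forall i, dotv u (H i).1 != (H i).2) ->
    \1_Rg u = 2%:R ^- #|S| * \sum_(J : {set 'I_k}) c J * sides H J u.
  move=> uH; transitivity (2%:R ^- #|S| * \prod_i (F i u + 1)).
    have -> : \prod_i (F i u + 1) = \prod_(i in S) (sg i * side (H i) u + 1).
      rewrite [RHS]big_mkcond; apply: eq_bigr => i _; rewrite /F.
      by case: ifP => // _; rewrite add0r.
    pose cond i := if eps i then (H i).2 <= dotv u (H i).1 else dotv u (H i).1 <= (H i).2.
    (* Off the hyperplane the factor is 2 on the side chosen by [eps] and 0 on the other, whence the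
       normalisation by [2 ^ #|S|]. *)
    have condE i : sg i * side (H i) u + 1 = if cond i then 2 else 0.
      rewrite /cond /sg /side -[_ <= dotv u _]subr_ge0 -[_ <= (H i).2]subr_le0.
      have : dotv u (H i).1 - (H i).2 != 0 by rewrite subr_eq0.
      move: (dotv u (H i).1 - (H i).2) => x.
      case: (eps i); case: (ltrgt0P x) => //= x0 _;
        rewrite ?(gtr0_sg x0) ?(ltr0_sg x0); lra.
    rewrite (eq_bigr _ (fun i _ => condE i)) indicE.
    case: (boolP [forall i in S, cond i]) => [/forall_inP h|].
      rewrite mem_set; last by move=> i iS; have := h i iS; rewrite /cond /halfspace /=; case: (eps i).
      rewrite (eq_bigr (fun=> 2)); last by move=> i /h ->.
      by rewrite prodr_const mulVf // expf_neq0 // pnatr_eq0.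
    move=> /forall_inPn [i iS ci]; rewrite memNset; last first.
      by move=> /(_ i iS); move: ci; rewrite /cond /halfspace /=; case: (eps i) => /negP.
    by rewrite (bigD1 i) //= (negbTE ci) mul0r mulr0.
  congr (_ * _); rewrite bigA_distr; apply: eq_big => [J|J _]; first by rewrite inE.
  exact: FE.
have cs0 : (correlation H finset.set0)%:E = mu setT.
  rewrite -correlationE (eq_integral (cst 1%:E)) ?integral_cst ?mul1e //.
  by move=> u _; rewrite /sides big_set0.
have intg (J : {set 'I_k}) : mu.-integrable setT
    (fun u : Rd R d => ((2%:R ^- #|S| * c J)%:E * (sides H J u)%:E)%E).
  by apply: integrableZl => //; exact: sides_integrable.
transitivity (\int[mu]_(u in [set: Rd R d]) (\1_(Rg : set (Rd R d)) u)%:E)%E; first by rewrite integral_indic // setIT.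
rewrite (ae_eq_integral (fun u : Rd R d =>
  \sum_(J : {set 'I_k}) ((2%:R ^- #|S| * c J)%:E * (sides H J u)%:E))%E) //.
- rewrite integral_sum // (bigD1 finset.set0) //= big1 => [|J J0].
    rewrite adde0 integralZl //; last exact: sides_integrable.
    by rewrite correlationE cs0 /c finset.sub0set big_set0 mulr1 muleC.
  rewrite integralZl //; last exact: sides_integrable.
  rewrite correlationE /c; case: ifP => JS; last by rewrite mulr0 mul0e.
  by rewrite cor0 // mule0.
- by apply/measurable_EFinP; exact: measurable_indic.
- by apply: (@measurable_int _ _ _ mu); apply: integrable_sum.
- have aeN : \forall u \ae mu, forall i, dotv u (H i).1 != (H i).2.
    apply: filter_forall => i; exists [set u : Rd R d | dotv u (H i).1 = (H i).2].
    split; first by apply: closed_measurable; exact: closed_dotv_eq.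
      exact: hyperplane_mass0.
    by move=> u /= /negP; rewrite negbK => /eqP.
  apply: (@filterS _ _ (ae_filter_ringOfSetsType mu) _ _ _ aeN) => u /E uE _.
  rewrite uE mulr_sumr -sumEFin; apply: eq_bigr => J _.
  by rewrite -EFinM mulrA.
Qed.
End Correlation.
End Masses.

(** * Equipartitions from common zeros *)

Section Equipartition.
Variables (R : realType) (k d : nat).
Implicit Types P : 'M[R]_(k, d).

(* The offset vanishes exactly where the row [P i] meets the boundary of the
   cube, so that negating such a row flips the sides of the hyperplane. *)
Definition hyperplanes P (i : 'I_k) : 'rV[R]_d * R :=
  (row i P, \prod_j (1 - P i j ^+ 2)).

Lemma sides_negate_row i P (A : {set 'I_k}) (u : Rd R d) :
  (exists j, `|P i j| = 1) ->
  sides (hyperplanes (negate_row i P)) A u =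
  (-1) ^+ (i \in A) * sides (hyperplanes P) A u.
Proof.
case=> j Pij.
have offset i' : \prod_j (1 - (negate_row i P) i' j ^+ 2) = \prod_j (1 - P i' j ^+ 2).
  by apply: eq_bigr => j' _; rewrite mxE; case: eqP => // ->; rewrite sqrrN.
have side_i' i' : i' != i ->
    side (hyperplanes (negate_row i P) i') u = side (hyperplanes P i') u.
  move=> i'i; rewrite /side /hyperplanes /= offset; congr (Num.sg (dotv u _ - _)).
  by apply/rowP => j'; rewrite !mxE (negbTE i'i).
have side_i : side (hyperplanes (negate_row i P) i) u = - side (hyperplanes P i) u.
  rewrite /side /hyperplanes /= offset (bigD1 j) //= -real_normK ?num_real //.
  rewrite Pij expr1n subrr mul0r !subr0 -sgrN; congr Num.sg.
  by rewrite /dotv -sumrN; apply: eq_bigr => j' _; rewrite !mxE eqxx mulrN.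
rewrite /sides; have [iA|iA] := boolP (i \in A); last first.
  rewrite expr0 mul1r; apply: eq_bigr => i' i'A; apply: side_i'.
  by apply: contraNneq iA => <-.
rewrite expr1 mulN1r (bigD1 i) //= [in RHS](bigD1 i) //= side_i mulNr.
by congr (- (_ * _)); apply: eq_bigr => i' /andP[_ i'i]; apply: side_i'.
Qed.

(** A common zero of the correlations gives the hyperplanes. Its rows must be nonzero, which a
    nonzero mass ensures; if all masses vanish, any hyperplanes do. *)
Lemma equipart_of_choice_count m l (e : 'I_k -> nat) :
  (0 < m)%N -> (0 < l)%N -> (0 < k)%N -> (0 < d)%N ->
  choice_count (@support k l m e) d != 0 -> equipart_property R m l k d.
Proof.
move=> m0 l0 k0 d0 cnt mu mu_ac.
case: (pselect (exists j, mu j setT != 0%E)) => [[j1 muj1]|mu0]; last first.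
  exists (fun _ => (const_mx 1, 0)); split=> [i|S _ j eps] /=.
    apply/eqP => /rowP /(_ (Ordinal d0)); rewrite !mxE => /eqP.
    by rewrite oner_eq0.
  have T0 : mu j setT = 0%E.
    by apply/eqP; apply: contrapT => h; apply: mu0; exists j; apply/negP.
  rewrite T0 mul0e; apply/eqP; rewrite -measure_le0 -T0.
  by apply: le_measure => //; rewrite inE //; apply: region_measurable.
(* The filler singletons are assigned the first mass. *)
pose idx (c : constraint l m e) : 'I_m :=
  match c with inl x => x.2 | inr _ => Ordinal m0 end.
pose G c P := correlation (mu (idx c)) (hyperplanes P) (support c).
have [c i P Pc Pb|c u P uc uP|P [_ PG]] := @common_zero R k d k0 d0 _ _ G cnt.
- apply: correlation_scale => v; exact: sides_negate_row.
- apply: correlation_cvg => // [i j|i|i].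
  + under eq_fun do rewrite mxE; rewrite mxE; exact: uP.
  + apply: cvg_prod_seq => j _; apply: cvgB; first exact: cvg_cst.
    by rewrite expr2; under eq_fun do rewrite expr2; apply: cvgM; exact: uP.
  + move=> /rowP Pi0; rewrite /hyperplanes /= big1 ?oner_eq0 // => j _.
    by have := Pi0 j; rewrite !mxE => ->; rewrite expr2 mul0r subr0.
have corP (A : {set 'I_k}) j : (0 < #|A| <= l)%N ->
    correlation (mu j) (hyperplanes P) A = 0.
  by move=> hA; have := PG (inl (exist _ A hA, j)).
(* A zero row has offset 1, so its side is constantly -1 and its correlation with [mu j1] would be
   minus the total mass. *)
have nz i : (hyperplanes P i).1 != 0.
  apply/eqP => /rowP Pi0.
  have : (correlation (mu j1) (hyperplanes P) [set i]%SET)%:E = 0%E.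
    by rewrite corP // cards1 l0.
  rewrite -correlationE (eq_integral (cst (-1)%:E)).
    rewrite integral_cst // => /eqP; rewrite mule_eq0 => /orP[|]; last exact/negP.
    by rewrite eqe oppr_eq0 oner_eq0.
  move=> u _; rewrite /sides big_set1 /side /dotv big1 => [|j _]; last first.
    by rewrite Pi0 mxE mulr0.
  rewrite /hyperplanes /= big1 => [|j _].
    by rewrite sub0r sgrN sgr1.
  by have := Pi0 j; rewrite !mxE => ->; rewrite expr2 mul0r subr0.
exists (hyperplanes P); split=> // S Sl j eps.
apply: region_measure => // A A0 AS; apply: corP.
by rewrite card_gt0 A0 -Sl subset_leq_card.
Qed.
End Equipartition.

Theorem theorem1p3 (R : realType) (q t k : nat) :
  (1 <= t)%N -> (t <= 2 ^ q)%N -> (2 <= k)%N ->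
  equipart_property R (2 ^ q.+1 - t) 2 k (2 ^ q * (k + 1) - t) /\
  equipart_property R (2 ^ q.+1 - t) 3 4 (7 * 2 ^ q - 2 * t).
Proof.
move=> t1 t2 k2; have tq : (1 <= t <= 2 ^ q)%N by rewrite t1 t2.
have m0 : (0 < 2 ^ q.+1 - t)%N by rewrite expnS; lia.
split.
  have [e] := pair_constraints (ltnW k2) tq.
  apply: equipart_of_choice_count => //; first exact: ltnW.
  by move: k2; set Q := (2 ^ q)%N in t2 *; nia.
have [e] := triple_constraints tq.
by apply: equipart_of_choice_count => //; lia.
Qed.
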